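(* Let $n\ge 0$ be an integer. Then $$\frac{T_{2n}(u)}{\sqrt{1-u^2}}\,\theta(1-u)=(-1)^n\frac{2}{\pi}\int_0^{\infty}\sin(ut)\,s_{0,2n}(t)\,dt\qquad (u>0,\ u\neq 1),$$ $$\frac{T_{2n+1}(u)}{\sqrt{1-u^2}}\,\theta(1-u)=(-1)^{n+1}(2n+1)\frac{2}{\pi}\int_0^{\infty}\cos(ut)\,s_{-1,2n+1}(t)\,dt\qquad (u\ge 0,\ u\neq 1),$$ and, for all real $t$, $$s_{0,2n}(t)=(-1)^n\int_0^1\sin(ut)\frac{T_{2n}(u)}{\sqrt{1-u^2}}\,du,$$ $$s_{-1,2n+1}(t)=\frac{(-1)^{n+1}}{2n+1} \int_0^1\cos(ut)\frac{T_{2n+1}(u)}{\sqrt{1-u^2}}\,du.$$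
   Context: The Lommel function is $$s_{\mu,\nu}(z)= \frac{z^{\mu+1}}{(\mu+1)^2-\nu^2}\;{}_1F_2\left(1;\frac{\mu-\nu+3}{2},\frac{\mu+\nu+3}{2};-\frac{z^2}{4}\right),$$ where ${}_1F_2(\alpha;\beta,\gamma;w)=\sum_{k\ge 0}\frac{(\alpha)_k}{(\beta)_k(\gamma)_k}\frac{w^k}{k!}$ and $(\alpha)_k$ is the Pochhammer symbol; for $\mu=-1$ the factor $z^{\mu+1}$ equals $1$. $T_m$ is the Chebyshev polynomial of the first kind, $T_m(\cos\phi)=\cos(m\phi)$. $\theta$ is the unit step function: $\theta(v)=1$ for $v>0$ and $\theta(v)=0$ for $v<0$; the left-hand sides containing $\theta(1-u)$ are understood to be $0$ for $u>1$. The integrals over $(0,\infty)$ are understood as improper integrals $\lim_{R\to\infty}\int_0^R$. *)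

(* Defs.v *)
From Stdlib Require Export Reals Factorial Lra Lia.
From Coquelicot Require Export Coquelicot.
Open Scope R_scope.

Fixpoint pochhammer (a : R) (k : nat) : R :=
  match k with
  | O => 1
  | S j => pochhammer a j * (a + INR j)
  end.

(* The quotients are meaningful when b and c are not nonpositive integers;
   the power series then converges for every w. *)
Definition hyp1F2 (a b c w : R) : R :=
  PSeries (fun k => pochhammer a k / (pochhammer b k * pochhammer c k)
                    / INR (fact k)) w.

(* The order mu is restricted to integers so that z ^ (mu + 1) is a
   single-valued power, also for z < 0; powerRZ 0 0 = 1, so for mu = -1 the
   prefactor is 1 at every z, including z = 0. *)
Definition lommel (mu : Z) (nu z : R) : R :=
  powerRZ z (mu + 1) / ((IZR mu + 1) ^ 2 - nu ^ 2)
  * hyp1F2 1 ((IZR mu - nu + 3) / 2) ((IZR mu + nu + 3) / 2) (- (z ^ 2 / 4)).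

Fixpoint chebyshevT (m : nat) (x : R) {struct m} : R :=
  match m with
  | O => 1
  | S m' => match m' with
            | O => x
            | S m'' => 2 * x * chebyshevT m' x - chebyshevT m'' x
            end
  end.

(* The characterization of T_m among polynomial functions. *)
Lemma chebyshevT_cos (m : nat) (phi : R) :
  chebyshevT m (cos phi) = cos (INR m * phi).
Proof.
enough (H : chebyshevT m (cos phi) = cos (INR m * phi) /\
            chebyshevT (S m) (cos phi) = cos (INR (S m) * phi)) by apply H.
induction m as [|m [IH1 IH2]].
- split; simpl.
  + now rewrite Rmult_0_l, cos_0.
  + now rewrite Rmult_1_l.
- split; [exact IH2|].
  change (chebyshevT (S (S m)) (cos phi))
    with (2 * cos phi * chebyshevT (S m) (cos phi) - chebyshevT m (cos phi)).
  rewrite IH1, IH2.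
  replace (INR (S (S m)) * phi) with (INR (S m) * phi + phi)
    by (rewrite !S_INR; ring).
  replace (INR m * phi) with (INR (S m) * phi - phi)
    by (rewrite !S_INR; ring).
  rewrite cos_plus, cos_minus; ring.
Qed.

(* The value at 0 is immaterial. In x / sqrt (1 - u ^ 2) * unit_step (1 - u)
   with u > 1 the square root is 0 and the quotient is some real number, so the
   product is 0. *)
Definition unit_step (v : R) : R := if Rlt_dec 0 v then 1 else 0.

(* The limit of the integral over [0, M] as M tends to +oo. *)
Notation ex_RInt_0_oo f :=
  (ex_RInt_gen f (at_point 0) (Rbar_locally p_infty)) (only parsing).
Notation RInt_0_oo f :=
  (RInt_gen f (at_point 0) (Rbar_locally p_infty)) (only parsing).

(* The limit of the integral over [0, c] as c tends to 1 from below: the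
   integrands have an integrable singularity at 1. *)
Notation ex_RInt_0_1 f :=
  (ex_RInt_gen f (at_point 0) (at_left 1)) (only parsing).
Notation RInt_0_1 f :=
  (RInt_gen f (at_point 0) (at_left 1)) (only parsing).

(* Main.v *)
Require Import Defs.
From Stdlib Require Import Reals.
From Coquelicot Require Import Coquelicot.
Open Scope R_scope.

(** Everything is done in the variable x with u = cos x, in which the weight
    1 / sqrt (1 - u ^ 2) disappears and T_m (u) becomes cos (m x).

    The formulas for the Lommel functions then read
      int_0^(pi/2) sin (t cos x) cos (m x) dx = cos (m pi/2) s_(0,m) (t),
      int_0^(pi/2) cos (t cos x) cos (m x) dx = - m sin (m pi/2) s_(-1,m) (t).
    Expanding sin or cos in powers of t cos x and integrating term by term
    ([is_series_RInt]) leaves the moments of cos ^ k against cos (m x). Two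
    integrations by parts relate the moment of order k + 2 to that of order k
    ([cos_moment_step]), and iterating this produces the Pochhammer symbols of
    the hypergeometric series ([cos_moment_odd], [cos_moment_even]).

    For the inverse formulas, integrate sin (u t) s_(0,2n) (t) or
    cos (u t) s_(-1,2n+1) (t) over t in [0, r] under the x-integral. With the
    kernel K_r (v) = sin (r v) / v, what remains is half of
      int cos (m x) K_r (u - cos x) dx - (-1) ^ m int cos (m x) K_r (u + cos x) dx.
    As T_m (y) - T_m (u) is y - u times a polynomial, replacing cos (m x) in the
    first integral, and (-1) ^ m cos (m x) = T_m (- cos x) in the second, by the
    constant T_m (u) costs only an integral of a smooth function times
    sin (r (u -+ cos x)), which tends to 0 by the Riemann-Lebesgue lemma
    ([is_lim_chebyshev_dirichlet]). The case m = 0 remains. There the kernel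
    integrals vanish in the limit as soon as u -+ cos x has no zero
    ([is_lim_dirichlet_nonvanishing]). For 0 < u = cos a < 1, multiplying
    K_r (cos a - cos x) by sin x instead of sin a changes it by a smooth function
    times a sine, because (sin a - sin x) / (cos a - cos x) = - cot ((a + x) / 2);
    and sin x K_r (cos a - cos x) integrates to values of the sine integral
    ([is_lim_dirichlet_interior]). The limit pi / 2 of the sine integral comes
    from the Dirichlet kernel 1 + 2 cos 2x + ... + 2 cos 2Nx ([is_lim_Si]). *)

(** * Integrals and series of real functions *)

Ltac by_derive :=
  apply (ex_derive_continuous (K := R_AbsRing) (V := R_NormedModule));
  auto_derive; auto.

Lemma is_RInt_primitive (F f : R -> R) (a b : R) :
  a <= b ->
  (forall x, a <= x <= b -> is_derive F x (f x)) ->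
  (forall x, a <= x <= b -> continuous f x) ->
  is_RInt f a b (F b - F a).
Proof.
intros Hab HF Hf.
apply (is_RInt_derive (V := R_CompleteNormedModule) F f a b);
  rewrite Rmin_left, Rmax_right by exact Hab; auto.
Qed.

Lemma ex_RInt_continuous_le (f : R -> R) (a b : R) :
  a <= b -> (forall x, a <= x <= b -> continuous f x) -> ex_RInt f a b.
Proof.
intros Hab Hf. apply (ex_RInt_continuous (V := R_CompleteNormedModule)).
rewrite Rmin_left, Rmax_right by exact Hab; auto.
Qed.

Lemma PI2_pos : 0 < PI / 2.
Proof. generalize PI_RGT_0; lra. Qed.

Lemma PI2_pos_le : 0 <= PI / 2.
Proof. generalize PI2_pos; lra. Qed.

Lemma is_RInt_det (f : R -> R) (a b l1 l2 : R) :
  is_RInt f a b l1 -> is_RInt f a b l2 -> l1 = l2.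
Proof.
intros H1 H2.
rewrite <- (is_RInt_unique (V := R_CompleteNormedModule) _ _ _ _ H1).
exact (is_RInt_unique (V := R_CompleteNormedModule) _ _ _ _ H2).
Qed.

(** The increments of the partial sums of [a] are dominated by those of [M];
    let the upper summation index tend to infinity. *)
Lemma series_tail_le (a M : nat -> R) (l S : R) (N : nat) :
  (forall k, Rabs (a k) <= M k) -> is_series a l -> is_series M S ->
  Rabs (l - sum_n a N) <= S - sum_n M N.
Proof.
intros Hle Ha HM.
apply (is_lim_seq_le (fun n => Rabs (sum_n a (N + n) - sum_n a N))
         (fun n => sum_n M (N + n) - sum_n M N)
         (Rabs (l - sum_n a N)) (S - sum_n M N)).
- induction n as [|n IH].
  + rewrite Nat.add_0_r, !Rminus_diag, Rabs_R0; lra.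
  + rewrite Nat.add_succ_r, !sum_Sn.
    unfold plus; simpl.
    replace (sum_n a (N + n) + a (Datatypes.S (N + n)) - sum_n a N)
      with ((sum_n a (N + n) - sum_n a N) + a (Datatypes.S (N + n))) by ring.
    eapply Rle_trans; [apply Rabs_triang|].
    generalize (Hle (Datatypes.S (N + n))); lra.
- apply (is_lim_seq_abs _ (l - sum_n a N)).
  apply (is_lim_seq_minus' _ _ l (sum_n a N)).
  + apply (is_lim_seq_ext (fun n => sum_n a (n + N))).
    { intros n; f_equal; lia. }
    apply (is_lim_seq_incr_n (sum_n a) N); exact Ha.
  + apply is_lim_seq_const.
- apply (is_lim_seq_minus' _ _ S (sum_n M N)).
  + apply (is_lim_seq_ext (fun n => sum_n M (n + N))).
    { intros n; f_equal; lia. }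
    apply (is_lim_seq_incr_n (sum_n M) N); exact HM.
  + apply is_lim_seq_const.
Qed.

Lemma is_RInt_sum_n (f : nat -> R -> R) (I : nat -> R) (a b : R) (N : nat) :
  (forall k, is_RInt (f k) a b (I k)) ->
  is_RInt (fun x => sum_n (fun k => f k x) N) a b (sum_n I N).
Proof.
intros Hf; induction N as [|N IH].
- rewrite sum_O. apply (is_RInt_ext (f 0%nat)); [|apply Hf].
  intros x _; now rewrite sum_O.
- rewrite sum_Sn.
  apply (is_RInt_ext (fun x => plus (sum_n (fun k => f k x) N) (f (S N) x))).
  + intros x _; now rewrite sum_Sn.
  + apply (is_RInt_plus _ _ _ _ _ _ IH (Hf (S N))).
Qed.

(** Weierstrass M-test: the tails of the series are bounded uniformly on [a, b]
    by the tails of [M], hence so are their integrals. *)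
Lemma is_series_RInt (f : nat -> R -> R) (I M : nat -> R) (F : R -> R)
  (a b L : R) :
  a <= b ->
  (forall k, is_RInt (f k) a b (I k)) ->
  (forall k x, a <= x <= b -> Rabs (f k x) <= M k) ->
  ex_series M ->
  (forall x, a <= x <= b -> is_series (fun k => f k x) (F x)) ->
  is_RInt F a b L ->
  is_series I L.
Proof.
intros Hab Hf HM [S HS] HF HL.
apply (is_lim_seq_le_le (fun N => L - (b - a) * (S - sum_n M N)) (sum_n I)
  (fun N => L + (b - a) * (S - sum_n M N)) L).
- intros N.
  assert (H : is_RInt (fun x => F x - sum_n (fun k => f k x) N) a b
                (L - sum_n I N)).
  { apply (is_RInt_minus F _ _ _ _ _ HL (is_RInt_sum_n f I a b N Hf)). }
  assert (H2 : Rabs (L - sum_n I N) <= (b - a) * (S - sum_n M N)).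
  { rewrite <- (is_RInt_unique _ _ _ _ H).
    apply abs_RInt_le_const; [exact Hab|eexists; exact H|].
    intros x Hx. apply series_tail_le; auto. }
  apply Rabs_le_between in H2; lra.
- assert (E : is_lim_seq (fun N => L - (b - a) * (S - sum_n M N))
                (L - (b - a) * (S - S))).
  { apply is_lim_seq_minus'; [apply is_lim_seq_const|].
    apply (is_lim_seq_scal_l _ (b - a) (S - S)).
    apply is_lim_seq_minus'; [apply is_lim_seq_const|exact HS]. }
  replace (L - (b - a) * (S - S)) with L in E by ring; exact E.
- assert (E : is_lim_seq (fun N => L + (b - a) * (S - sum_n M N))
                (L + (b - a) * (S - S))).
  { apply is_lim_seq_plus'; [apply is_lim_seq_const|].
    apply (is_lim_seq_scal_l _ (b - a) (S - S)).
    apply is_lim_seq_minus'; [apply is_lim_seq_const|exact HS]. }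
  replace (L + (b - a) * (S - S)) with L in E by ring; exact E.
Qed.

(** * Moments of powers of the cosine *)

Definition cos_moment (m : R) (k : nat) : R :=
  RInt (fun x => cos x ^ k * cos (m * x)) 0 (PI / 2).

Lemma is_RInt_cos_moment (m : R) (k : nat) :
  is_RInt (fun x => cos x ^ k * cos (m * x)) 0 (PI / 2) (cos_moment m k).
Proof.
apply (RInt_correct (V := R_CompleteNormedModule) (fun x => cos x ^ k * cos (m * x))).
apply ex_RInt_continuous_le; [exact PI2_pos_le|].
intros x _; by_derive.
Qed.

(** Two integrations by parts, starting from
    (cos ^ (k+2))'' = (k+2)(k+1) cos ^ k - (k+2)^2 cos ^ (k+2). The boundary terms
    carry a factor sin at 0 and a factor cos at pi / 2, so they all vanish. *)
Lemma cos_moment_step (m : R) (k : nat) :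
  INR (k + 2) * INR (k + 1) * cos_moment m k
  = (INR (k + 2) ^ 2 - m ^ 2) * cos_moment m (k + 2).
Proof.
(* P = (cos ^ (k+2))' cos (m x) + m cos ^ (k+2) sin (m x), which is 0 at both ends. *)
set (P := fun x => - INR (k + 2) * cos x ^ (k + 1) * sin x * cos (m * x)
                   + m * (cos x ^ (k + 2) * sin (m * x))).
assert (H : is_RInt
  (fun x => INR (k + 2) * INR (k + 1) * (cos x ^ k * cos (m * x))
          - (INR (k + 2) ^ 2 - m ^ 2) * (cos x ^ (k + 2) * cos (m * x)))
  0 (PI / 2) (P (PI / 2) - P 0)).
{ apply is_RInt_primitive; [exact PI2_pos_le| |].
  - intros x _. unfold P. auto_derive; [auto|].
    replace (pred (k + 1)) with k by lia.
    replace (pred (k + 2)) with (S k) by lia.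
    replace (k + 2)%nat with (S (S k)) by lia.
    replace (k + 1)%nat with (S k) by lia.
    rewrite !S_INR. simpl.
    generalize (sin2_cos2 x); unfold Rsqr; intros E.
    replace (cos x * (cos x * cos x ^ k))
      with ((1 - sin x * sin x) * cos x ^ k)
      by (replace (1 - sin x * sin x) with (cos x * cos x) by lra; ring).
    ring_simplify.
    replace (cos x ^ 2) with (1 - sin x ^ 2) by (simpl; lra).
    ring.
  - intros x _. by_derive. }
assert (H2 : is_RInt
  (fun x => INR (k + 2) * INR (k + 1) * (cos x ^ k * cos (m * x))
          - (INR (k + 2) ^ 2 - m ^ 2) * (cos x ^ (k + 2) * cos (m * x)))
  0 (PI / 2) (INR (k + 2) * INR (k + 1) * cos_moment m k
          - (INR (k + 2) ^ 2 - m ^ 2) * cos_moment m (k + 2))).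
{ apply (is_RInt_minus (V := R_NormedModule));
  apply (is_RInt_scal (V := R_NormedModule));
  apply is_RInt_cos_moment. }
generalize (is_RInt_det _ _ _ _ _ H H2); clear H H2; unfold P; intros H2.
rewrite (Rmult_0_r m), cos_PI2, sin_0 in H2.
rewrite !pow_ne_zero in H2 by lia. lra.
Qed.

Lemma cos_moment_0 (m : R) : m * cos_moment m 0 = sin (m * (PI / 2)).
Proof.
assert (H : is_RInt (fun x => m * (cos x ^ 0 * cos (m * x))) 0 (PI / 2)
  (sin (m * (PI / 2)) - sin (m * 0))).
{ apply (is_RInt_primitive (fun x => sin (m * x))); [exact PI2_pos_le| |].
  - intros x _. auto_derive; [auto|]. simpl; ring.
  - intros x _. by_derive. }
assert (H2 := is_RInt_scal (V := R_NormedModule) _ _ _ m _ (is_RInt_cos_moment m 0)).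
generalize (is_RInt_det _ _ _ _ _ H2 H); rewrite Rmult_0_r, sin_0, Rminus_0_r.
intros E; exact E.
Qed.

(** The recurrence of [cos_moment_step] cannot start below 0; here the boundary
    term of the integration by parts at pi / 2 survives. *)
Lemma cos_moment_1 (m : R) : (1 - m ^ 2) * cos_moment m 1 = cos (m * (PI / 2)).
Proof.
set (P := fun x => sin x * cos (m * x) - m * (cos x * sin (m * x))).
assert (H : is_RInt (fun x => (1 - m ^ 2) * (cos x ^ 1 * cos (m * x))) 0 (PI / 2)
  (P (PI / 2) - P 0)).
{ apply is_RInt_primitive; [exact PI2_pos_le| |].
  - intros x _. unfold P. auto_derive; [auto|]. ring.
  - intros x _. by_derive. }
assert (H2 := is_RInt_scal (V := R_NormedModule)
  _ _ _ (1 - m ^ 2) _ (is_RInt_cos_moment m 1)).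
replace (cos (m * (PI / 2))) with (P (PI / 2) - P 0).
- exact (is_RInt_det _ _ _ _ _ H2 H).
- unfold P. rewrite cos_PI2, sin_PI2, sin_0, !Rmult_0_r, sin_0. ring.
Qed.

(** * The Lommel functions as trigonometric integrals *)

Lemma pochhammer_1 (k : nat) : pochhammer 1 k = INR (fact k).
Proof.
induction k as [|k IH]; [reflexivity|].
change (fact (S k)) with (S k * fact k)%nat.
rewrite mult_INR, S_INR. simpl. rewrite IH. ring.
Qed.

Lemma pochhammer_neq_0 (a : R) (k : nat) :
  (forall j, a + INR j <> 0) -> pochhammer a k <> 0.
Proof.
intros Ha; induction k as [|k IH]; simpl; [lra|].
apply Rmult_integral_contrapositive_currified; auto.
Qed.

Lemma is_series_eq (a b : nat -> R) (l : R) :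
  (forall k, a k = b k) -> is_series a l -> is_series b l.
Proof. exact (is_series_ext a b l). Qed.

Lemma is_series_sin (x : R) :
  is_series (fun k => (-1) ^ k * x ^ (2 * k + 1) / INR (fact (2 * k + 1))) (sin x).
Proof.
unfold sin. destruct (exist_sin (Rsqr x)) as [l Hl].
apply (is_series_eq (fun k => x * (sin_n k * Rsqr x ^ k))).
- intros k. unfold sin_n. rewrite pow_add, pow_mult, pow_1, Rsqr_pow2.
  unfold Rdiv. ring.
- apply (is_series_scal (V := R_NormedModule)). apply is_series_Reals. exact Hl.
Qed.

Lemma is_series_cos (x : R) :
  is_series (fun k => (-1) ^ k * x ^ (2 * k) / INR (fact (2 * k))) (cos x).
Proof.
unfold cos. destruct (exist_cos (Rsqr x)) as [l Hl].
apply (is_series_eq (fun k => cos_n k * Rsqr x ^ k)).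
- intros k. unfold cos_n. rewrite pow_mult, Rsqr_pow2.
  unfold Rdiv. ring.
- apply is_series_Reals. exact Hl.
Qed.

(** Replacing the factorial of [j] by the smaller one of [k] makes the bound, for
    j = 2k or 2k + 1, the general term of an exponential series in t ^ 2. *)
Lemma trig_term_le (t c d : R) (k j : nat) :
  (k <= j)%nat -> Rabs c <= 1 -> Rabs d <= 1 ->
  Rabs ((-1) ^ k * (t * c) ^ j / INR (fact j) * d)
  <= Rabs t ^ j / INR (fact k).
Proof.
intros Hkj Hc Hd.
assert (Hf : 0 < INR (fact k)) by apply INR_fact_lt_0.
assert (Hf' : INR (fact k) <= INR (fact j)) by (apply le_INR, fact_le, Hkj).
unfold Rdiv. rewrite !Rabs_mult, pow_1_abs, Rabs_inv, Rmult_1_l.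
rewrite (Rabs_pos_eq (INR (fact j))) by lra.
rewrite <- RPow_abs, Rabs_mult, Rpow_mult_distr.
rewrite <- (Rmult_1_r (Rabs t ^ j * / INR (fact k))).
assert (0 <= Rabs t ^ j) by (apply pow_le, Rabs_pos).
assert (0 <= Rabs c ^ j <= 1).
{ split; [apply pow_le, Rabs_pos|].
  rewrite <- (pow1 j). apply pow_incr. split; [apply Rabs_pos|exact Hc]. }
assert (0 < / INR (fact j)) by (apply Rinv_0_lt_compat; lra).
apply Rmult_le_compat; try apply Rabs_pos; try exact Hd.
- apply Rmult_le_pos; [apply Rmult_le_pos|]; lra.
- apply Rmult_le_compat; try nra.
  apply Rinv_le_contravar; assumption.
Qed.

Lemma ex_series_eq (a b : nat -> R) :
  (forall k, a k = b k) -> ex_series a -> ex_series b.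
Proof. exact (ex_series_ext a b). Qed.

Lemma ex_series_exp (x : R) : ex_series (fun k => x ^ k / INR (fact k)).
Proof.
exists (exp x). generalize (is_exp_Reals x). unfold is_pseries.
apply is_series_eq. intros k. rewrite pow_n_pow. unfold scal; simpl; unfold mult; simpl.
reflexivity.
Qed.

(** The integral of sin (u t) T_m (u) / sqrt (1 - u ^ 2) over (0, 1), written in
    the variable x with u = cos x, for an arbitrary real order m. *)
Definition cos_sin_transform (m t : R) : R :=
  RInt (fun x => sin (t * cos x) * cos (m * x)) 0 (PI / 2).

Definition cos_cos_transform (m t : R) : R :=
  RInt (fun x => cos (t * cos x) * cos (m * x)) 0 (PI / 2).

Lemma is_RInt_cos_sin_transform (m t : R) :
  is_RInt (fun x => sin (t * cos x) * cos (m * x)) 0 (PI / 2)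
    (cos_sin_transform m t).
Proof.
apply (RInt_correct (V := R_CompleteNormedModule)
         (fun x => sin (t * cos x) * cos (m * x))).
apply ex_RInt_continuous_le; [exact PI2_pos_le|]. intros x _; by_derive.
Qed.

Lemma is_RInt_cos_cos_transform (m t : R) :
  is_RInt (fun x => cos (t * cos x) * cos (m * x)) 0 (PI / 2)
    (cos_cos_transform m t).
Proof.
apply (RInt_correct (V := R_CompleteNormedModule)
         (fun x => cos (t * cos x) * cos (m * x))).
apply ex_RInt_continuous_le; [exact PI2_pos_le|]. intros x _; by_derive.
Qed.

Lemma Rabs_cos_le_1 (x : R) : Rabs (cos x) <= 1.
Proof. apply Rabs_le, COS_bound. Qed.

Lemma is_series_cos_sin_transform (m t : R) :
  is_series (fun k => (-1) ^ k * t ^ (2 * k + 1) / INR (fact (2 * k + 1))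
                      * cos_moment m (2 * k + 1))
    (cos_sin_transform m t).
Proof.
apply (is_series_RInt
  (fun k x => (-1) ^ k * (t * cos x) ^ (2 * k + 1) / INR (fact (2 * k + 1))
              * cos (m * x)) _
  (fun k => Rabs t ^ (2 * k + 1) / INR (fact k))
  (fun x => sin (t * cos x) * cos (m * x)) 0 (PI / 2)).
- exact PI2_pos_le.
- intros k.
  apply (is_RInt_ext (V := R_NormedModule)
   (fun x => (-1) ^ k * t ^ (2 * k + 1) / INR (fact (2 * k + 1))
      * (cos x ^ (2 * k + 1) * cos (m * x)))).
  + intros x _. rewrite Rpow_mult_distr. unfold Rdiv. simpl. ring.
  + apply (is_RInt_scal (V := R_NormedModule)), is_RInt_cos_moment.
- intros k x _. apply trig_term_le; [lia|apply Rabs_cos_le_1..].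
- apply (ex_series_eq (fun k => Rabs t * ((Rabs t ^ 2) ^ k / INR (fact k)))).
  + intros k. rewrite pow_add, pow_mult, pow_1. unfold Rdiv. simpl. ring.
  + apply (ex_series_scal (V := R_NormedModule)), ex_series_exp.
- intros x _. apply is_series_scal_r, is_series_sin.
- apply is_RInt_cos_sin_transform.
Qed.

Lemma is_series_cos_cos_transform (m t : R) :
  is_series (fun k => (-1) ^ k * t ^ (2 * k) / INR (fact (2 * k))
                      * cos_moment m (2 * k))
    (cos_cos_transform m t).
Proof.
apply (is_series_RInt
  (fun k x => (-1) ^ k * (t * cos x) ^ (2 * k) / INR (fact (2 * k))
              * cos (m * x)) _
  (fun k => Rabs t ^ (2 * k) / INR (fact k))
  (fun x => cos (t * cos x) * cos (m * x)) 0 (PI / 2)).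
- exact PI2_pos_le.
- intros k.
  apply (is_RInt_ext (V := R_NormedModule)
   (fun x => (-1) ^ k * t ^ (2 * k) / INR (fact (2 * k))
      * (cos x ^ (2 * k) * cos (m * x)))).
  + intros x _. rewrite Rpow_mult_distr. unfold Rdiv. simpl. ring.
  + apply (is_RInt_scal (V := R_NormedModule)), is_RInt_cos_moment.
- intros k x _. apply trig_term_le; [lia|apply Rabs_cos_le_1..].
- apply (ex_series_eq (fun k => (Rabs t ^ 2) ^ k / INR (fact k))).
  + intros k. now rewrite pow_mult.
  + apply ex_series_exp.
- intros x _. apply is_series_scal_r, is_series_cos.
- apply is_RInt_cos_cos_transform.
Qed.

Lemma fact_SS (j : nat) :
  INR (fact (j + 2)) = INR (j + 2) * INR (j + 1) * INR (fact j).
Proof.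
replace (j + 2)%nat with (S (S j)) by lia.
replace (j + 1)%nat with (S j) by lia.
change (fact (S (S j))) with (S (S j) * (S j * fact j))%nat.
rewrite !mult_INR. ring.
Qed.

(** Each step of the recurrence brings (2k+3)^2 - m^2, which is 4 times the
    product of the next factors of the two Pochhammer symbols. The identity is
    kept multiplied out so that the induction involves no division. *)
Lemma cos_moment_odd (m : R) (k : nat) :
  (1 - m ^ 2) * 4 ^ k * pochhammer ((3 - m) / 2) k * pochhammer ((3 + m) / 2) k
  * cos_moment m (2 * k + 1)
  = cos (m * (PI / 2)) * INR (fact (2 * k + 1)).
Proof.
induction k as [|k IH].
- simpl. rewrite <- cos_moment_1. field.
- replace (2 * S k + 1)%nat with ((2 * k + 1) + 2)%nat by lia.
  assert (E := cos_moment_step m (2 * k + 1)).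
  rewrite fact_SS. simpl pochhammer. simpl (4 ^ S k).
  replace (cos (m * (PI / 2)) * _) with
    (INR (2 * k + 1 + 2) * INR (2 * k + 1 + 1) *
     (cos (m * (PI / 2)) * INR (fact (2 * k + 1)))) by ring.
  rewrite <- IH.
  transitivity ((1 - m ^ 2) * 4 ^ k * pochhammer ((3 - m) / 2) k
    * pochhammer ((3 + m) / 2) k
    * ((INR (2 * k + 1 + 2) ^ 2 - m ^ 2) * cos_moment m (2 * k + 1 + 2))).
  + rewrite !plus_INR, mult_INR. simpl INR. field.
  + rewrite <- E. ring.
Qed.

Lemma cos_moment_even (m : R) (k : nat) :
  m ^ 2 * 4 ^ k * pochhammer ((2 - m) / 2) k * pochhammer ((2 + m) / 2) k
  * cos_moment m (2 * k)
  = m * sin (m * (PI / 2)) * INR (fact (2 * k)).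
Proof.
induction k as [|k IH].
- simpl. rewrite <- cos_moment_0. field.
- replace (2 * S k)%nat with (2 * k + 2)%nat by lia.
  assert (E := cos_moment_step m (2 * k)).
  rewrite fact_SS. simpl pochhammer. simpl (4 ^ S k).
  replace (m * sin (m * (PI / 2)) * _) with
    (INR (2 * k + 2) * INR (2 * k + 1) *
     (m * sin (m * (PI / 2)) * INR (fact (2 * k)))) by ring.
  rewrite <- IH.
  transitivity (m ^ 2 * 4 ^ k * pochhammer ((2 - m) / 2) k
    * pochhammer ((2 + m) / 2) k
    * ((INR (2 * k + 2) ^ 2 - m ^ 2) * cos_moment m (2 * k + 2))).
  + rewrite !plus_INR, mult_INR. simpl INR. field.
  + rewrite <- E. ring.
Qed.

(** The hypothesis excludes exactly the orders m for which a denominator of the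
    hypergeometric series or of its prefactor vanishes. The two series then agree
    term by term. *)
Lemma cos_sin_transform_lommel (m t : R) :
  (forall j : nat, (2 * INR j + 1) ^ 2 - m ^ 2 <> 0) ->
  cos_sin_transform m t = cos (m * (PI / 2)) * lommel 0 m t.
Proof.
intros Hm.
rewrite <- (is_series_unique _ _ (is_series_cos_sin_transform m t)).
unfold lommel, hyp1F2, PSeries.
rewrite <- Rmult_assoc, <- Series_scal_l.
apply Series_ext. intros k.
replace (IZR 0 - m + 3) with (3 - m) by ring.
replace (IZR 0 + m + 3) with (3 + m) by ring.
assert (E := cos_moment_odd m k).
assert (H1 : 1 - m ^ 2 <> 0) by (generalize (Hm 0%nat); simpl; lra).
assert (Hp : pochhammer ((3 - m) / 2) k <> 0).
{ apply pochhammer_neq_0. intros j Hj. apply (Hm (S j)). rewrite S_INR.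
  replace m with (2 * INR j + 3) by lra. ring. }
assert (Hq : pochhammer ((3 + m) / 2) k <> 0).
{ apply pochhammer_neq_0. intros j Hj. apply (Hm (S j)). rewrite S_INR.
  replace m with (- (2 * INR j + 3)) by lra. ring. }
assert (Hf : INR (fact (2 * k + 1)) <> 0) by apply INR_fact_neq_0.
assert (Hk : INR (fact k) <> 0) by apply INR_fact_neq_0.
assert (H4 : 4 ^ k <> 0) by (apply pow_nonzero; lra).
replace (cos_moment m (2 * k + 1)) with
  (cos (m * (PI / 2)) * INR (fact (2 * k + 1)) /
    ((1 - m ^ 2) * 4 ^ k * pochhammer ((3 - m) / 2) k * pochhammer ((3 + m) / 2) k))
  by (rewrite <- E; field; auto).
rewrite pochhammer_1.
replace (- (t ^ 2 / 4)) with (-1 * t ^ 2 * / 4) by field.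
rewrite !Rpow_mult_distr, pow_inv, pow_add, pow_mult, pow_1.
change (powerRZ t (0 + 1)) with (t ^ 1). rewrite pow_1.
change ((t * (t * 1))) with (t ^ 2).
field. repeat split; auto.
Qed.

Lemma cos_cos_transform_lommel (m t : R) :
  (forall j : nat, (2 * INR j) ^ 2 - m ^ 2 <> 0) ->
  cos_cos_transform m t = - m * sin (m * (PI / 2)) * lommel (-1) m t.
Proof.
intros Hm.
rewrite <- (is_series_unique _ _ (is_series_cos_cos_transform m t)).
unfold lommel, hyp1F2, PSeries.
rewrite <- Rmult_assoc, <- Series_scal_l.
apply Series_ext. intros k.
replace (IZR (-1) - m + 3) with (2 - m) by ring.
replace (IZR (-1) + m + 3) with (2 + m) by ring.
assert (E := cos_moment_even m k).
assert (H1 : m <> 0) by (intros ->; generalize (Hm 0%nat); simpl; lra).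
assert (Hp : pochhammer ((2 - m) / 2) k <> 0).
{ apply pochhammer_neq_0. intros j Hj. apply (Hm (S j)). rewrite S_INR.
  replace m with (2 * INR j + 2) by lra. ring. }
assert (Hq : pochhammer ((2 + m) / 2) k <> 0).
{ apply pochhammer_neq_0. intros j Hj. apply (Hm (S j)). rewrite S_INR.
  replace m with (- (2 * INR j + 2)) by lra. ring. }
assert (Hf : INR (fact (2 * k)) <> 0) by apply INR_fact_neq_0.
assert (Hk : INR (fact k) <> 0) by apply INR_fact_neq_0.
assert (H4 : 4 ^ k <> 0) by (apply pow_nonzero; lra).
replace (cos_moment m (2 * k)) with
  (m * sin (m * (PI / 2)) * INR (fact (2 * k)) /
    (m ^ 2 * 4 ^ k * pochhammer ((2 - m) / 2) k * pochhammer ((2 + m) / 2) k))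
  by (rewrite <- E; field; auto).
rewrite pochhammer_1.
replace (- (t ^ 2 / 4)) with (-1 * t ^ 2 * / 4) by field.
rewrite !Rpow_mult_distr, pow_inv, pow_mult.
change (powerRZ t (-1 + 1)) with 1.
field. repeat split; auto.
Qed.

(** * The substitution u = cos x *)

Lemma is_RInt_gen_of_lim (f I : R -> R) (a l : R) (F : (R -> Prop) -> Prop)
  {FF : Filter F} :
  F (fun c => is_RInt f a c (I c)) -> filterlim I F (locally l) ->
  is_RInt_gen f (at_point a) F l.
Proof.
intros Hf Hl P HP.
apply (Filter_prod _ _ _ (fun x => x = a) (fun c => is_RInt f a c (I c) /\ P (I c))).
- reflexivity.
- apply filter_and; [exact Hf|exact (Hl P HP)].
- intros x c -> [H1 H2]. exists (I c). split; [exact H1|exact H2].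
Qed.

Lemma is_RInt_gen_value (f : R -> R) (a l : R) (F : (R -> Prop) -> Prop)
  {FF : ProperFilter F} :
  is_RInt_gen f (at_point a) F l ->
  ex_RInt_gen f (at_point a) F /\ RInt_gen f (at_point a) F = l.
Proof.
intros H; split; [exists l; exact H|].
apply (is_RInt_gen_unique (V := R_CompleteNormedModule)), H.
Qed.

Lemma ball_Rabs (x y eps : R) : ball x eps y -> Rabs (y - x) < eps.
Proof. exact (fun H => H). Qed.

Lemma is_derive_RInt_cont (f : R -> R) (a x : R) :
  (forall y, continuous f y) -> is_derive (fun y => RInt f a y) x (f x).
Proof.
intros Hf. apply (is_derive_RInt f _ a x).
- apply filter_forall. intros y.
  apply (RInt_correct (V := R_CompleteNormedModule)).
  apply (ex_RInt_continuous (V := R_CompleteNormedModule)). auto.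
- apply Hf.
Qed.

Lemma is_derive_acos (x : R) :
  -1 < x < 1 -> is_derive acos x (-1 / sqrt (1 - x ^ 2)).
Proof.
intros Hx. replace (1 - x ^ 2) with (1 - Rsqr x) by (unfold Rsqr; ring).
apply is_derive_Reals. rewrite <- (derive_pt_acos x Hx).
apply (proj1 (derive_pt_eq acos x _ (derivable_pt_acos x Hx)) eq_refl).
Qed.

Lemma filterlim_acos_left_1 : filterlim acos (at_left 1) (locally 0).
Proof.
intros P [eps HP].
set (e := Rmin eps (PI / 2)).
assert (He : 0 < e <= PI / 2 /\ e <= eps).
{ unfold e. generalize (cond_pos eps) PI2_pos; intros H1 H2.
  split; [split|].
  - now apply Rmin_glb_lt.
  - apply Rmin_r.
  - apply Rmin_l. }
assert (Hc : cos e < 1).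
{ rewrite <- cos_0. apply cos_decreasing_1; generalize PI_RGT_0; lra. }
assert (Hc0 : 0 <= cos e) by (apply cos_ge_0; lra).
exists (mkposreal (1 - cos e) (proj2 (Rlt_0_minus _ _) Hc)).
intros c Hcb Hc1. apply HP.
assert (Hce : cos e < c).
{ apply ball_Rabs in Hcb. simpl in Hcb. apply Rabs_lt_between in Hcb. lra. }
assert (Ha := acos_bound c).
change (Rabs (acos c - 0) < eps).
rewrite Rminus_0_r, Rabs_pos_eq by lra.
apply Rnot_le_lt. intros Hle.
assert (H : cos (acos c) <= cos e) by (apply cos_decr_1; lra).
rewrite cos_acos in H by lra. lra.
Qed.

(** The substitution is carried out on [0, c] with c < 1, where acos is
    differentiable; then acos c tends to 0 as c tends to 1. *)
Lemma is_RInt_gen_chebyshev_weight (h : R -> R) :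
  (forall x, continuous h x) ->
  is_RInt_gen (fun u => h u / sqrt (1 - u ^ 2)) (at_point 0) (at_left 1)
    (RInt (fun x => h (cos x)) 0 (PI / 2)).
Proof.
intros Hh.
assert (Hhc : forall x, continuous (fun x => h (cos x)) x).
{ intros x. apply (continuous_comp cos h); [by_derive|apply Hh]. }
set (G := fun x => RInt (fun y => h (cos y)) 0 x).
assert (HG : forall x, is_derive G x (h (cos x))).
{ intros x. apply (is_derive_RInt_cont (fun y => h (cos y))), Hhc. }
apply (is_RInt_gen_of_lim _ (fun c => G (PI / 2) - G (acos c))).
- typeclasses eauto.
- exists (mkposreal 1 Rlt_0_1). intros c Hcb Hc1.
  assert (Hc0 : 0 < c).
  { apply ball_Rabs in Hcb. simpl in Hcb. apply Rabs_lt_between in Hcb. lra. }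
  replace (G (PI / 2) - G (acos c)) with (- G (acos c) - - G (acos 0))
    by (rewrite acos_0; ring).
  apply (is_RInt_primitive (fun u => - G (acos u))); [lra| |].
  + intros x Hx.
    assert (Hs : sqrt (1 - x ^ 2) <> 0).
    { apply Rgt_not_eq, sqrt_lt_R0. simpl. nra. }
    replace (h x / sqrt (1 - x ^ 2))
      with (- (-1 / sqrt (1 - x ^ 2) * h (cos (acos x))))
      by (rewrite cos_acos by lra; field; exact Hs).
    apply (is_derive_opp (fun u => G (acos u))).
    apply (is_derive_comp G acos x); [apply HG|].
    apply is_derive_acos; lra.
  + intros x Hx. apply (continuous_mult h (fun u => / sqrt (1 - u ^ 2))); [apply Hh|].
    assert (0 < 1 - x ^ 2) by (simpl; nra).
    by_derive. split; [assumption|]. split; [|exact I].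
    apply Rgt_not_eq, sqrt_lt_R0. assumption.
- assert (E : G (PI / 2) - G 0 = G (PI / 2)).
  { assert (E0 : G 0 = 0) by apply (RInt_point (V := R_CompleteNormedModule)).
    rewrite E0. apply Rminus_0_r. }
  assert (H : filterlim (fun c => G (PI / 2) - G (acos c)) (at_left 1)
                (locally (G (PI / 2) - G 0))).
  { apply (filterlim_comp _ _ _ acos (fun y => G (PI / 2) - G y) _ (locally 0)).
    - apply filterlim_acos_left_1.
    - apply (continuous_minus (fun _ => G (PI / 2)) G); [apply continuous_const|].
      apply (ex_derive_continuous (V := R_NormedModule)). eexists; apply HG. }
  rewrite E in H. exact H.
Qed.

(** * The kernel sin (r x) / x *)

Definition sinc (x : R) : R := if Req_dec_T x 0 then 1 else sin x / x.

Lemma sinc_0 : sinc 0 = 1.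
Proof. unfold sinc. destruct (Req_dec_T 0 0); [reflexivity|lra]. Qed.

Lemma mult_sinc (x : R) : x * sinc x = sin x.
Proof.
unfold sinc. destruct (Req_dec_T x 0) as [->|Hx].
- rewrite sin_0; ring.
- field; exact Hx.
Qed.

Lemma sinc_neq_0 (x : R) : x <> 0 -> sinc x = sin x / x.
Proof. intros Hx. rewrite <- mult_sinc. field; exact Hx. Qed.

Lemma sinc_opp (x : R) : sinc (- x) = sinc x.
Proof.
destruct (Req_dec_T x 0) as [->|Hx]; [now rewrite Ropp_0|].
rewrite !sinc_neq_0, sin_neg by lra. field; exact Hx.
Qed.

Lemma continuous_sinc (x : R) : continuous sinc x.
Proof.
destruct (Req_dec_T x 0) as [->|Hx].
- apply continuity_pt_filterlim, continuity_pt_filterlim'.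
  rewrite sinc_0.
  apply (is_lim_ext_loc (fun x => sin x / x) sinc 0 1).
  + exists (mkposreal 1 Rlt_0_1). intros y _ Hy. now rewrite sinc_neq_0.
  + exact is_lim_sinc_0.
- apply (continuous_ext_loc _ (fun x => sin x / x)).
  + exists (mkposreal _ (Rabs_pos_lt _ Hx)). intros y Hy.
    rewrite sinc_neq_0; [reflexivity|]. intros ->.
    apply ball_Rabs in Hy. rewrite Rminus_0_l, Rabs_Ropp in Hy. simpl in Hy. lra.
  + by_derive.
Qed.

(** This is sin (r x) / x, extended by its limit r at x = 0; it is also the integral
    of cos (t x) for t from 0 to r, see [is_derive_dirichlet_kernel]. The form
    through [sinc] makes it continuous in x everywhere. *)
Definition dirichlet_kernel (r x : R) : R := r * sinc (r * x).

Lemma mult_dirichlet_kernel (r x : R) : x * dirichlet_kernel r x = sin (r * x).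
Proof. unfold dirichlet_kernel. rewrite <- mult_sinc. ring. Qed.

Lemma dirichlet_kernel_neq_0 (r x : R) :
  x <> 0 -> dirichlet_kernel r x = sin (r * x) / x.
Proof. intros Hx. rewrite <- mult_dirichlet_kernel. field; exact Hx. Qed.

Lemma dirichlet_kernel_x_0 (r : R) : dirichlet_kernel r 0 = r.
Proof. unfold dirichlet_kernel. rewrite Rmult_0_r, sinc_0. ring. Qed.

Lemma dirichlet_kernel_0_x (x : R) : dirichlet_kernel 0 x = 0.
Proof. unfold dirichlet_kernel. ring. Qed.

Lemma continuous_dirichlet_kernel (r x : R) : continuous (dirichlet_kernel r) x.
Proof.
apply (continuous_mult (fun _ => r) (fun x => sinc (r * x))).
- apply continuous_const.
- apply (continuous_comp (fun x => r * x) sinc); [by_derive|apply continuous_sinc].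
Qed.

Lemma is_derive_dirichlet_kernel (r x : R) :
  is_derive (fun r => dirichlet_kernel r x) r (cos (r * x)).
Proof.
destruct (Req_dec_T x 0) as [->|Hx].
- apply (is_derive_ext (fun r => r)).
  + intros s; now rewrite dirichlet_kernel_x_0.
  + auto_derive; [auto|]. now rewrite Rmult_0_r, cos_0.
- apply (is_derive_ext (fun r => sin (r * x) / x)).
  + intros s; now rewrite dirichlet_kernel_neq_0.
  + auto_derive; [auto|]. field; exact Hx.
Qed.

Lemma continuity_2d_pt_snd (w : R -> R) (x y : R) :
  continuous w y -> continuity_2d_pt (fun _ v => w v) x y.
Proof.
intros Hw. apply (continuity_1d_2d_pt_comp w (fun _ v => v)).
- apply continuity_pt_filterlim, Hw.
- apply continuity_2d_pt_id2.
Qed.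

Lemma is_derive_RInt_dirichlet_kernel (w g : R -> R) (b r : R) :
  (forall x, continuous w x) -> (forall x, continuous g x) ->
  is_derive (fun r => RInt (fun x => w x * dirichlet_kernel r (g x)) 0 b) r
    (RInt (fun x => w x * cos (r * g x)) 0 b).
Proof.
intros Hw Hg.
assert (HD : forall s x, is_derive (fun s => w x * dirichlet_kernel s (g x)) s
                           (w x * cos (s * g x))).
{ intros s x. apply (is_derive_scal (fun s => dirichlet_kernel s (g x))).
  apply is_derive_dirichlet_kernel. }
assert (E : RInt (fun x => Derive (fun s => w x * dirichlet_kernel s (g x)) r) 0 b
            = RInt (fun x => w x * cos (r * g x)) 0 b).
{ apply (RInt_ext (V := R_CompleteNormedModule)). intros x _.
  apply is_derive_unique, HD. }
rewrite <- E.
apply (is_derive_RInt_param (fun r x => w x * dirichlet_kernel r (g x)) 0 b r).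
- apply filter_forall. intros s x _. eexists; apply HD.
- intros x _.
  apply (continuity_2d_pt_ext (fun u v => w v * cos (u * g v))).
  { intros s y. symmetry. apply is_derive_unique, HD. }
  apply continuity_2d_pt_mult; [now apply continuity_2d_pt_snd|].
  apply (continuity_1d_2d_pt_comp cos); [apply continuity_cos|].
  apply continuity_2d_pt_mult; [apply continuity_2d_pt_id1|].
  now apply continuity_2d_pt_snd.
- apply filter_forall. intros s.
  apply (ex_RInt_continuous (V := R_CompleteNormedModule)). intros x _.
  apply (continuous_mult w (fun x => dirichlet_kernel s (g x))); [apply Hw|].
  apply (continuous_comp g (dirichlet_kernel s));
    [apply Hg|apply continuous_dirichlet_kernel].
Qed.

Lemma continuous_RInt_cos (w g : R -> R) (b r : R) :
  (forall x, continuous w x) -> (forall x, continuous g x) ->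
  continuous (fun r => RInt (fun x => w x * cos (r * g x)) 0 b) r.
Proof.
intros Hw Hg.
apply (ex_derive_continuous (V := R_NormedModule)). eexists.
assert (HD : forall s x, is_derive (fun s => w x * cos (s * g x)) s
                           (w x * (- sin (s * g x) * g x))).
{ intros s x. auto_derive; [auto|]. ring. }
apply (is_derive_RInt_param (fun r x => w x * cos (r * g x)) 0 b r).
- apply filter_forall. intros s x _. eexists; apply HD.
- intros x _.
  apply (continuity_2d_pt_ext (fun u v => w v * (- sin (u * g v) * g v))).
  { intros s y. symmetry. apply is_derive_unique, HD. }
  apply continuity_2d_pt_mult; [now apply continuity_2d_pt_snd|].
  apply continuity_2d_pt_mult; [|now apply continuity_2d_pt_snd].
  apply continuity_2d_pt_opp.
  apply (continuity_1d_2d_pt_comp sin); [apply continuity_sin|].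
  apply continuity_2d_pt_mult; [apply continuity_2d_pt_id1|].
  now apply continuity_2d_pt_snd.
- apply filter_forall. intros s.
  apply (ex_RInt_continuous (V := R_CompleteNormedModule)). intros x _.
  apply (continuous_mult w (fun x => cos (s * g x))); [apply Hw|].
  apply (continuous_comp g (fun y => cos (s * y))); [apply Hg|by_derive].
Qed.

(** Exchange of the two integrations: as functions of [r] both sides vanish at 0
    and have the same derivative, by differentiation under the integral sign. *)
Lemma is_RInt_RInt_cos (w g : R -> R) (b r : R) :
  0 <= r -> (forall x, continuous w x) -> (forall x, continuous g x) ->
  is_RInt (fun t => RInt (fun x => w x * cos (t * g x)) 0 b) 0 r
    (RInt (fun x => w x * dirichlet_kernel r (g x)) 0 b).
Proof.
intros Hr Hw Hg.
set (F := fun r => RInt (fun x => w x * dirichlet_kernel r (g x)) 0 b).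
assert (E0 : F 0 = 0).
{ unfold F.
  rewrite (RInt_ext (V := R_CompleteNormedModule) _ (fun _ => 0)).
  - rewrite (RInt_const (V := R_CompleteNormedModule)). apply Rmult_0_r.
  - intros x _. rewrite dirichlet_kernel_0_x. apply Rmult_0_r. }
change (is_RInt (fun t => RInt (fun x => w x * cos (t * g x)) 0 b) 0 r (F r)).
replace (F r) with (F r - F 0) by (rewrite E0; ring).
apply is_RInt_primitive; [exact Hr| |].
- intros t _. now apply is_derive_RInt_dirichlet_kernel.
- intros t _. now apply continuous_RInt_cos.
Qed.

(** * The Riemann-Lebesgue lemma *)

(** On [0, d] the integral is at most [d * M]; on [d, b] an integration by parts
    makes it O(1 / r). In the application to phi = cos, [G] is a quotient by phi',
    which vanishes at 0: hence the half-open interval. The integrand [g] comes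
    after [r0] because the Dirichlet kernels [g] of [Si_odd_multiples] exist for
    odd integers [r] only. *)
Lemma riemann_lebesgue (G G' phi phi' : R -> R) (b M eps : R) :
  0 < b -> 0 < M -> 0 < eps ->
  (forall x, 0 < x <= b -> is_derive G x (G' x)) ->
  (forall x, 0 < x <= b -> continuous G' x) ->
  (forall x, 0 < x <= b -> is_derive phi x (phi' x)) ->
  (forall x, 0 < x <= b -> continuous phi' x) ->
  exists r0, 0 < r0 /\ forall r (g : R -> R), r0 <= r ->
    (forall x, 0 <= x <= b -> continuous g x) ->
    (forall x, 0 <= x <= b -> Rabs (g x) <= M) ->
    (forall x, 0 < x <= b -> g x = G x * phi' x * sin (r * phi x)) ->
    Rabs (RInt g 0 b) < eps.
Proof.
intros Hb HM He HG HG' Hphi Hphi'.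
(* d makes the piece near 0 contribute at most eps / 2. *)
set (d := Rmin b (eps / (2 * M))).
assert (Hd : 0 < d <= b /\ d * M <= eps / 2).
{ assert (0 < eps / (2 * M)) by (apply Rdiv_lt_0_compat; lra).
  unfold d; split; [split|].
  - now apply Rmin_glb_lt.
  - apply Rmin_l.
  - apply Rle_trans with (eps / (2 * M) * M).
    + apply Rmult_le_compat_r; [lra|apply Rmin_r].
    + right; field; lra. }
(* C / r bounds the piece over [d, b]: boundary terms and total variation of G. *)
set (V := RInt (fun x => Rabs (G' x)) d b).
set (C := Rabs (G b) + Rabs (G d) + Rabs V).
assert (HC : 0 <= C).
{ unfold C. generalize (Rabs_pos (G b)) (Rabs_pos (G d)) (Rabs_pos V); lra. }
exists (2 * C / eps + 1).
assert (Hq : 0 <= 2 * C / eps)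
  by (apply Rmult_le_pos; [lra|left; now apply Rinv_0_lt_compat]).
split; [lra|].
intros r g Hr Hg HgM Hgeq.
assert (Hr0 : 0 < r) by lra.
assert (HCr : C / r < eps / 2).
{ apply Rmult_lt_reg_r with r; [lra|]. unfold Rdiv at 1.
  rewrite Rmult_assoc, Rinv_l, Rmult_1_r by lra.
  apply Rlt_le_trans with (eps / 2 * (2 * C / eps + 1)).
  - replace (eps / 2 * (2 * C / eps + 1)) with (C + eps / 2) by (field; lra). lra.
  - apply Rmult_le_compat_l; lra. }
assert (E1 : ex_RInt g 0 d)
  by (apply ex_RInt_continuous_le; [lra|]; intros x Hx; apply Hg; lra).
assert (E2 : ex_RInt g d b)
  by (apply ex_RInt_continuous_le; [lra|]; intros x Hx; apply Hg; lra).
rewrite <- (RInt_Chasles (V := R_CompleteNormedModule) g 0 d b E1 E2).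
assert (Hc : forall x, d <= x <= b -> continuous (fun x => G' x * cos (r * phi x)) x).
{ intros x Hx.
  apply (continuous_mult G' (fun x => cos (r * phi x))); [apply HG'; lra|].
  apply (continuous_comp phi (fun y => cos (r * y))); [|by_derive].
  apply (ex_derive_continuous (V := R_NormedModule)). eexists; apply Hphi; lra. }
assert (B1 : Rabs (RInt g 0 d) <= d * M).
{ replace (d * M) with ((d - 0) * M) by ring.
  apply abs_RInt_le_const; [lra|exact E1|]. intros x Hx. apply HgM; lra. }
assert (B2 : Rabs (RInt (fun x => G' x * cos (r * phi x)) d b) <= Rabs V).
{ eapply Rle_trans; [apply abs_RInt_le; [lra|]|].
  - apply ex_RInt_continuous_le; [lra|exact Hc].
  - eapply Rle_trans; [|apply Rle_abs].
    apply RInt_le; [lra| | |].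
    + apply ex_RInt_continuous_le; [lra|]. intros x Hx.
      apply (continuous_comp _ Rabs); [now apply Hc|apply continuous_Rabs].
    + apply ex_RInt_continuous_le; [lra|]. intros x Hx.
      apply (continuous_comp _ Rabs); [apply HG'; lra|apply continuous_Rabs].
    + intros x Hx. rewrite Rabs_mult.
      rewrite <- (Rmult_1_r (Rabs (G' x))) at 2.
      apply Rmult_le_compat_l; [apply Rabs_pos|apply Rabs_cos_le_1]. }
assert (EQ : is_RInt g d b
   ((- G b * cos (r * phi b) / r - - G d * cos (r * phi d) / r)
    + / r * RInt (fun x => G' x * cos (r * phi x)) d b)).
{ apply (is_RInt_ext (V := R_NormedModule)
    (fun x => (G x * phi' x * sin (r * phi x) - G' x * cos (r * phi x) / r)
              + / r * (G' x * cos (r * phi x)))).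
  { intros x. rewrite Rmin_left, Rmax_right by lra. intros Hx.
    rewrite Hgeq by lra. unfold Rdiv. simpl. ring. }
  apply (is_RInt_plus (V := R_NormedModule)).
  - apply (is_RInt_primitive (fun x => - G x * cos (r * phi x) / r)); [lra| |].
    + intros x Hx.
      assert (H1 := HG x ltac:(lra)). assert (H2 := Hphi x ltac:(lra)).
      auto_derive.
      * split; [eexists; exact H1|]. split; [eexists; exact H2|exact I].
      * replace (Derive (fun x => G x) x) with (G' x)
          by (symmetry; exact (is_derive_unique _ _ _ H1)).
        replace (Derive (fun x => phi x) x) with (phi' x)
          by (symmetry; exact (is_derive_unique _ _ _ H2)).
        field; lra.
    + intros x Hx.
      apply (continuous_minus (fun x => G x * phi' x * sin (r * phi x))
               (fun x => G' x * cos (r * phi x) / r)).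
      * apply (continuous_mult (fun x => G x * phi' x) (fun x => sin (r * phi x))).
        -- apply (continuous_mult G phi'); [|apply Hphi'; lra].
           apply (ex_derive_continuous (V := R_NormedModule)). eexists; apply HG; lra.
        -- apply (continuous_comp phi (fun y => sin (r * y))); [|by_derive].
           apply (ex_derive_continuous (V := R_NormedModule)). eexists; apply Hphi; lra.
      * apply (continuous_mult (fun x => G' x * cos (r * phi x)) (fun _ => / r));
          [now apply Hc|apply continuous_const].
  - apply (is_RInt_scal (V := R_NormedModule)).
    apply (RInt_correct (V := R_CompleteNormedModule)
      (fun x => G' x * cos (r * phi x))).
    apply ex_RInt_continuous_le; [lra|exact Hc]. }
rewrite (is_RInt_unique (V := R_CompleteNormedModule) _ _ _ _ EQ).
set (X := RInt (fun x => G' x * cos (r * phi x)) d b) in *.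
change (Rabs (RInt g 0 d + (- G b * cos (r * phi b) / r
  - - G d * cos (r * phi d) / r + / r * X)) < eps).
eapply Rle_lt_trans; [apply Rabs_triang|].
apply Rle_lt_trans with (d * M + C / r); [|lra].
apply Rplus_le_compat; [exact B1|].
replace (- G b * cos (r * phi b) / r - - G d * cos (r * phi d) / r + / r * X)
  with ((- (G b * cos (r * phi b)) + G d * cos (r * phi d) + X) / r)
  by (field; lra).
unfold Rdiv.
rewrite Rabs_mult, (Rabs_pos_eq (/ r)) by (left; now apply Rinv_0_lt_compat).
apply Rmult_le_compat_r; [left; now apply Rinv_0_lt_compat|].
unfold C.
assert (Hcos : forall a y, Rabs (a * cos y) <= Rabs a).
{ intros a y. rewrite Rabs_mult. rewrite <- (Rmult_1_r (Rabs a)) at 2.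
  apply Rmult_le_compat_l; [apply Rabs_pos|apply Rabs_cos_le_1]. }
eapply Rle_trans; [apply Rabs_triang|]. apply Rplus_le_compat; [|exact B2].
eapply Rle_trans; [apply Rabs_triang|]. rewrite Rabs_Ropp.
apply Rplus_le_compat; apply Hcos.
Qed.

Lemma continuous_bounded (f : R -> R) (a b : R) :
  a <= b -> (forall x, a <= x <= b -> continuous f x) ->
  exists M, 0 < M /\ forall x, a <= x <= b -> Rabs (f x) <= M.
Proof.
intros Hab Hf.
destruct (continuity_ab_maj (fun x => Rabs (f x)) a b Hab) as [y [Hy _]].
- intros x Hx. apply continuity_pt_filterlim.
  apply (continuous_comp f Rabs); [now apply Hf|apply continuous_Rabs].
- exists (Rabs (f y) + 1). split; [generalize (Rabs_pos (f y)); lra|].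
  intros x Hx. generalize (Hy x Hx); lra.
Qed.

Lemma is_lim_p_infty_0 (f : R -> R) :
  (forall eps, 0 < eps -> exists r0, forall r, r0 <= r -> Rabs (f r) < eps) ->
  is_lim f p_infty 0.
Proof.
intros H. apply is_lim_spec. intros eps. simpl.
destruct (H eps (cond_pos eps)) as [r0 H0].
exists r0. intros r Hr. rewrite Rminus_0_r. apply H0; lra.
Qed.

(** The phase is stationary at x = 0 only, which is the endpoint that
    [riemann_lebesgue] allows to be critical. *)
Lemma riemann_lebesgue_cos_phase (f f' : R -> R) (u s : R) :
  s <> 0 ->
  (forall x, 0 <= x <= PI / 2 -> is_derive f x (f' x)) ->
  (forall x, 0 <= x <= PI / 2 -> continuous f' x) ->
  is_lim (fun r => RInt (fun x => f x * sin (r * (u + s * cos x))) 0 (PI / 2))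
    p_infty 0.
Proof.
intros Hs Hf Hf'.
assert (Hfc : forall x, 0 <= x <= PI / 2 -> continuous f x).
{ intros x Hx. apply (ex_derive_continuous (V := R_NormedModule)).
  eexists; now apply Hf. }
destruct (continuous_bounded f 0 (PI / 2) PI2_pos_le Hfc) as [M [HM HfM]].
assert (Hsin : forall x, 0 < x <= PI / 2 -> sin x <> 0).
{ intros x Hx. apply Rgt_not_eq, sin_gt_0; generalize PI_RGT_0; lra. }
apply is_lim_p_infty_0. intros eps He.
destruct (riemann_lebesgue (fun x => - f x / (s * sin x))
  (* The derivative of - f / (s sin). *)
  (fun x => (f x * cos x - f' x * sin x) / (s * sin x ^ 2))
  (fun x => u + s * cos x) (fun x => - s * sin x) (PI / 2) M eps PI2_pos HM He)
  as [r0 [_ H]].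
- intros x Hx. assert (H1 := Hf x ltac:(lra)). assert (H2 := Hsin x Hx).
  auto_derive.
  + split; [eexists; exact H1|]. split; [|exact I].
    now apply Rmult_integral_contrapositive_currified.
  + replace (Derive (fun x => f x) x) with (f' x)
      by (symmetry; exact (is_derive_unique _ _ _ H1)).
    field; auto.
- intros x Hx. assert (H2 := Hsin x Hx).
  apply (continuous_mult (fun x => f x * cos x - f' x * sin x)
           (fun x => / (s * sin x ^ 2))).
  + apply (continuous_minus (fun x => f x * cos x) (fun x => f' x * sin x)).
    * apply (continuous_mult f cos); [apply Hfc; lra|by_derive].
    * apply (continuous_mult f' sin); [apply Hf'; lra|by_derive].
  + by_derive.
    apply Rmult_integral_contrapositive_currified; [exact Hs|].
    simpl. rewrite Rmult_1_r.
    now apply Rmult_integral_contrapositive_currified.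
- intros x _. auto_derive; [auto|ring].
- intros x _. by_derive.
- exists r0. intros r Hr. apply (H r); [exact Hr| | |].
  + intros x Hx.
    apply (continuous_mult f (fun x => sin (r * (u + s * cos x))));
      [now apply Hfc|by_derive].
  + intros x Hx. rewrite Rabs_mult. rewrite <- (Rmult_1_r M).
    apply Rmult_le_compat; try apply Rabs_pos; [now apply HfM|].
    apply Rabs_le, SIN_bound.
  + intros x Hx. field. split; [now apply Hsin|exact Hs].
Qed.

(** * Reduction to the order 0 *)

(** The quotient (T_m (x) - T_m (u)) / (x - u) is a polynomial in x; all that matters
    is that it is continuously differentiable, also at x = u. *)
Lemma chebyshevT_divided_difference (m : nat) (u : R) :
  exists Q Q' : R -> R,
    (forall x, chebyshevT m x - chebyshevT m u = (x - u) * Q x) /\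
    (forall x, is_derive Q x (Q' x)) /\ (forall x, continuous Q' x).
Proof.
enough (H : forall k, k = m \/ k = S m -> exists Q Q' : R -> R,
    (forall x, chebyshevT k x - chebyshevT k u = (x - u) * Q x) /\
    (forall x, is_derive Q x (Q' x)) /\ (forall x, continuous Q' x)) by auto.
induction m as [|m IH].
- intros k [->| ->].
  + exists (fun _ => 0), (fun _ => 0). split; [|split].
    * intros x; simpl; ring.
    * intros x; auto_derive; auto.
    * intros x; apply continuous_const.
  + exists (fun _ => 1), (fun _ => 0). split; [|split].
    * intros x; simpl; ring.
    * intros x; auto_derive; auto.
    * intros x; apply continuous_const.
- intros k [->| ->]; [apply IH; auto|].
  destruct (IH m) as [P [P' [HP1 [HP2 HP3]]]]; [auto|].
  destruct (IH (S m)) as [Q [Q' [HQ1 [HQ2 HQ3]]]]; [auto|].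
  exists (fun x => 2 * x * Q x + 2 * chebyshevT (S m) u - P x),
         (fun x => 2 * Q x + 2 * x * Q' x - P' x). split; [|split].
  + intros x.
    change (chebyshevT (S (S m)) x)
      with (2 * x * chebyshevT (S m) x - chebyshevT m x).
    change (chebyshevT (S (S m)) u)
      with (2 * u * chebyshevT (S m) u - chebyshevT m u).
    transitivity (2 * x * (chebyshevT (S m) x - chebyshevT (S m) u)
      + 2 * (x - u) * chebyshevT (S m) u - (chebyshevT m x - chebyshevT m u)).
    { ring. }
    rewrite HP1, HQ1. ring.
  + intros x. assert (H1 := HP2 x). assert (H2 := HQ2 x).
    auto_derive.
    * split; [eexists; exact H2|]. split; [eexists; exact H1|exact I].
    * replace (Derive (fun x => P x) x) with (P' x)
        by (symmetry; exact (is_derive_unique _ _ _ H1)).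
      replace (Derive (fun x => Q x) x) with (Q' x)
        by (symmetry; exact (is_derive_unique _ _ _ H2)).
      ring.
  + intros x.
    apply (continuous_minus (fun x => 2 * Q x + 2 * x * Q' x) P'); [|apply HP3].
    apply (continuous_plus (fun x => 2 * Q x) (fun x => 2 * x * Q' x)).
    * apply (continuous_mult (fun _ => 2) Q); [apply continuous_const|].
      apply (ex_derive_continuous (V := R_NormedModule)). eexists; apply HQ2.
    * apply (continuous_mult (fun x => 2 * x) Q'); [by_derive|apply HQ3].
Qed.

Lemma continuous_dirichlet_kernel_cos (r u s x : R) :
  continuous (fun x => dirichlet_kernel r (u + s * cos x)) x.
Proof.
apply (continuous_comp (fun x => u + s * cos x) (dirichlet_kernel r));
  [by_derive|apply continuous_dirichlet_kernel].
Qed.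

(** With y = - s cos x the argument of the kernel is u - y, so that
    (T_m (y) - T_m (u)) K_r (u - y) = - Q (y) sin (r (u - y)) with Q the divided
    difference, and the singularity of the kernel is gone. *)
Lemma is_lim_chebyshev_dirichlet (m : nat) (u s l : R) :
  s ^ 2 = 1 ->
  is_lim (fun r => chebyshevT m u
            * RInt (fun x => dirichlet_kernel r (u + s * cos x)) 0 (PI / 2))
    p_infty l ->
  is_lim (fun r => RInt (fun x => chebyshevT m (- s * cos x)
                          * dirichlet_kernel r (u + s * cos x)) 0 (PI / 2))
    p_infty l.
Proof.
intros Hs Hl.
assert (Hs0 : s <> 0) by (intros ->; simpl in Hs; lra).
destruct (chebyshevT_divided_difference m u) as [Q [Q' [HQ [HQ1 HQ2]]]].
assert (HD : forall x, is_derive (fun x => Q (- s * cos x)) x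
                         (s * sin x * Q' (- s * cos x))).
{ intros x. apply (is_derive_comp Q (fun x => - s * cos x)); [apply HQ1|].
  auto_derive; [auto|ring]. }
assert (HC : forall x, continuous (fun x => Q (- s * cos x)) x).
{ intros x. apply (ex_derive_continuous (V := R_NormedModule)).
  eexists; apply HD. }
assert (HRL := riemann_lebesgue_cos_phase (fun x => Q (- s * cos x))
  (fun x => s * sin x * Q' (- s * cos x)) u s Hs0).
assert (Hlim := is_lim_minus' _ _ _ l 0 Hl (HRL (fun x _ => HD x) ltac:(
  intros x _; apply (continuous_mult (fun x => s * sin x) (fun x => Q' (- s * cos x)));
  [by_derive|apply (continuous_comp (fun x => - s * cos x) Q'); [by_derive|apply HQ2]]))).
rewrite Rminus_0_r in Hlim. revert Hlim.
apply is_lim_ext. intros r. symmetry.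
apply (is_RInt_unique (V := R_CompleteNormedModule)).
apply (is_RInt_ext (V := R_NormedModule)
 (fun x => chebyshevT m u * dirichlet_kernel r (u + s * cos x)
           - Q (- s * cos x) * sin (r * (u + s * cos x)))).
- intros x _. rewrite <- mult_dirichlet_kernel.
  assert (E := HQ (- s * cos x)).
  change (chebyshevT m u * dirichlet_kernel r (u + s * cos x) -
    Q (- s * cos x) * ((u + s * cos x) * dirichlet_kernel r (u + s * cos x)) =
    chebyshevT m (- s * cos x) * dirichlet_kernel r (u + s * cos x)).
  replace (chebyshevT m (- s * cos x))
    with (chebyshevT m u + (- s * cos x - u) * Q (- s * cos x)) by lra.
  ring.
- apply (is_RInt_minus (V := R_NormedModule)).
  + apply (is_RInt_scal (V := R_NormedModule)).
    apply (RInt_correct (V := R_CompleteNormedModule)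
      (fun x => dirichlet_kernel r (u + s * cos x))).
    apply ex_RInt_continuous_le; [exact PI2_pos_le|].
    intros x _; apply continuous_dirichlet_kernel_cos.
  + apply (RInt_correct (V := R_CompleteNormedModule)
      (fun x => Q (- s * cos x) * sin (r * (u + s * cos x)))).
    apply ex_RInt_continuous_le; [exact PI2_pos_le|]. intros x _.
    apply (continuous_mult (fun x => Q (- s * cos x))
      (fun x => sin (r * (u + s * cos x)))); [apply HC|by_derive].
Qed.

Lemma is_lim_dirichlet_nonvanishing (u s : R) :
  s <> 0 -> (forall x, 0 <= x <= PI / 2 -> u + s * cos x <> 0) ->
  is_lim (fun r => RInt (fun x => dirichlet_kernel r (u + s * cos x)) 0 (PI / 2))
    p_infty 0.
Proof.
intros Hs Hu.
apply (is_lim_ext (fun r => RInt (fun x => / (u + s * cos x)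
                                * sin (r * (u + s * cos x))) 0 (PI / 2))).
- intros r. apply (RInt_ext (V := R_CompleteNormedModule)). intros x.
  rewrite Rmin_left, Rmax_right by exact PI2_pos_le. intros Hx.
  rewrite dirichlet_kernel_neq_0 by (apply Hu; lra). apply Rmult_comm.
- apply (riemann_lebesgue_cos_phase _ (fun x => s * sin x / (u + s * cos x) ^ 2));
    [exact Hs| |].
  + intros x Hx. assert (H := Hu x Hx). auto_derive; [auto|]. field; exact H.
  + intros x Hx. assert (H := Hu x Hx). by_derive.
Qed.

(** * The sine integral *)

(** The periodic analogue of [dirichlet_kernel]: it is sin ((2N+1) x) / sin x,
    see [sin_mult_dirichlet_sum], written so as to be defined at 0. *)
Fixpoint dirichlet_sum (N : nat) (x : R) : R :=
  match N with
  | O => 1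
  | S k => dirichlet_sum k x + 2 * cos (2 * INR (S k) * x)
  end.

Lemma sin_mult_dirichlet_sum (N : nat) (x : R) :
  sin x * dirichlet_sum N x = sin (INR (2 * N + 1) * x).
Proof.
induction N as [|N IH].
- simpl. rewrite Rmult_1_l. ring.
- cbn [dirichlet_sum]. rewrite Rmult_plus_distr_l, IH.
  rewrite !plus_INR, !mult_INR, !S_INR. simpl INR.
  replace ((1 + 1) * INR N + 1) with (2 * (INR N + 1) - 1) by ring.
  replace (((0 + 1 + 1) * INR N + (0 + 1)) * x) with (2 * (INR N + 1) * x - x) by ring.
  replace (((0 + 1 + 1) * (INR N + 1) + (0 + 1)) * x)
    with (2 * (INR N + 1) * x + x) by ring.
  rewrite sin_minus, sin_plus. ring.
Qed.

Lemma dirichlet_sum_0 (N : nat) : dirichlet_sum N 0 = INR (2 * N + 1).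
Proof.
induction N as [|N IH]; [simpl; ring|].
cbn [dirichlet_sum]. rewrite IH, Rmult_0_r, cos_0.
rewrite !plus_INR, !mult_INR, !S_INR. simpl INR. ring.
Qed.

Lemma continuous_dirichlet_sum (N : nat) (x : R) : continuous (dirichlet_sum N) x.
Proof.
induction N as [|N IH]; [apply continuous_const|].
apply (continuous_plus (dirichlet_sum N) (fun x => 2 * cos (2 * INR (S N) * x)));
  [exact IH|]. apply (ex_derive_continuous (V := R_NormedModule)). auto_derive; auto.
Qed.

Lemma sin_INR_PI (k : nat) : sin (INR k * PI) = 0.
Proof.
induction k as [|k IH]; [simpl; now rewrite Rmult_0_l, sin_0|].
rewrite S_INR. replace ((INR k + 1) * PI) with (INR k * PI + PI) by ring.
rewrite neg_sin, IH. ring.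
Qed.

Lemma is_RInt_dirichlet_sum (N : nat) :
  is_RInt (dirichlet_sum N) 0 (PI / 2) (PI / 2).
Proof.
induction N as [|N IH].
- replace (PI / 2) with (PI / 2 - 0) at 2 by ring.
  apply (is_RInt_primitive (fun x => x)); [exact PI2_pos_le| |].
  + intros x _. simpl. auto_derive; auto.
  + intros x _. apply continuous_const.
- replace (PI / 2) with (PI / 2 + (/ INR (S N) * sin (2 * INR (S N) * (PI / 2))
      - / INR (S N) * sin (2 * INR (S N) * 0))) at 2.
  + apply (is_RInt_plus (V := R_NormedModule) (dirichlet_sum N)
      (fun x => 2 * cos (2 * INR (S N) * x))); [exact IH|].
    apply (is_RInt_primitive (fun x => / INR (S N) * sin (2 * INR (S N) * x)));
      [exact PI2_pos_le| |].
    * intros x _. auto_derive; [auto|]. rewrite <- (Rmult_1_l (2 * cos _)).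
      assert (INR (S N) <> 0) by (apply not_0_INR; lia).
      simpl INR in *. field. assumption.
    * intros x _. apply (ex_derive_continuous (V := R_NormedModule)). auto_derive; auto.
  + replace (2 * INR (S N) * (PI / 2)) with (INR (S N) * PI) by field.
    rewrite sin_INR_PI, !Rmult_0_r, sin_0. ring.
Qed.

Lemma sin_cubic_lower (x : R) : 0 <= x <= PI / 2 -> x - x ^ 3 / 6 <= sin x.
Proof.
intros Hx. destruct (sin_bound x 0) as [H _]; [lra|generalize PI_RGT_0; lra|].
revert H. unfold sin_approx, sin_term. simpl. intros H. lra.
Qed.

Lemma inv_sin_minus_inv_bound (x : R) :
  0 < x <= PI / 2 -> Rabs (/ sin x - / x) <= 1.
Proof.
intros Hx.
assert (Hs : 0 < sin x) by (apply sin_gt_0; generalize PI_RGT_0; lra).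
assert (H1 : sin x <= x) by (left; apply sin_lt_x; lra).
assert (H2 := sin_cubic_lower x ltac:(lra)).
assert (H4 := PI_4).
assert (H3 : x - sin x <= x * sin x).
{ assert (x * (1 + x) * (1 - x ^ 2 / 6) >= x); [|nra].
  replace (x * (1 + x) * (1 - x ^ 2 / 6)) with
    (x + x ^ 2 * (1 - x / 6 - x ^ 2 / 6)) by field.
  assert (0 <= 1 - x / 6 - x ^ 2 / 6) by (simpl; nra).
  assert (0 <= x ^ 2) by apply pow2_ge_0. nra. }
replace (/ sin x - / x) with ((x - sin x) / (x * sin x)) by (field; lra).
assert (0 < x * sin x) by (apply Rmult_lt_0_compat; lra).
rewrite Rabs_pos_eq.
- apply Rmult_le_reg_r with (x * sin x); [assumption|].
  unfold Rdiv. rewrite Rmult_assoc, Rinv_l by lra. lra.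
- apply Rmult_le_pos; [lra|]. left; now apply Rinv_0_lt_compat.
Qed.

Definition Si (y : R) : R := RInt sinc 0 y.

Lemma is_derive_Si (y : R) : is_derive Si y (sinc y).
Proof. apply is_derive_RInt_cont, continuous_sinc. Qed.

Lemma Si_0 : Si 0 = 0.
Proof. apply (RInt_point (V := R_CompleteNormedModule)). Qed.

Lemma is_RInt_sinc (a b : R) : is_RInt sinc a b (RInt sinc a b).
Proof.
apply (RInt_correct (V := R_CompleteNormedModule)).
apply (ex_RInt_continuous (V := R_CompleteNormedModule)).
intros x _; apply continuous_sinc.
Qed.

Lemma Si_opp (y : R) : Si (- y) = - Si y.
Proof.
assert (H : is_RInt sinc (- 0) (- y) (Si (- y))).
{ rewrite Ropp_0. apply is_RInt_sinc. }
apply (is_RInt_comp_opp (V := R_NormedModule)) in H.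
apply (is_RInt_det (fun x => - sinc (- x)) 0 y); [exact H|].
apply (is_RInt_ext (V := R_NormedModule) (fun x => - sinc x)).
- intros x _. now rewrite sinc_opp.
- apply (is_RInt_opp (V := R_NormedModule)), is_RInt_sinc.
Qed.

Lemma is_RInt_dirichlet_kernel_comp (r a b : R) (phi phi' : R -> R) :
  a <= b ->
  (forall x, is_derive phi x (phi' x)) -> (forall x, continuous phi' x) ->
  is_RInt (fun x => phi' x * dirichlet_kernel r (phi x)) a b
    (Si (r * phi b) - Si (r * phi a)).
Proof.
intros Hab Hphi Hphi'.
apply (is_RInt_primitive (fun x => Si (r * phi x))); [exact Hab| |].
- intros x _. unfold dirichlet_kernel.
  replace (phi' x * (r * sinc (r * phi x)))
    with (r * phi' x * sinc (r * phi x)) by ring.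
  apply (is_derive_comp Si (fun x => r * phi x)); [apply is_derive_Si|].
  apply (is_derive_scal phi), Hphi.
- intros x _.
  apply (continuous_mult phi' (fun x => dirichlet_kernel r (phi x))); [apply Hphi'|].
  apply (continuous_comp phi (dirichlet_kernel r));
    [|apply continuous_dirichlet_kernel].
  apply (ex_derive_continuous (V := R_NormedModule)). eexists; apply Hphi.
Qed.

(** With r = 2N + 1, the integral of sin (r x) / sin x over [0, pi/2] is pi/2, that of
    sin (r x) / x is Si (r pi/2), and the difference, in which 1 / sin x - 1 / x is
    bounded, tends to 0 by [riemann_lebesgue]. *)
Lemma Si_odd_multiples (eps : R) :
  0 < eps -> exists r0, forall N, r0 <= INR (2 * N + 1) ->
    Rabs (Si (INR (2 * N + 1) * (PI / 2)) - PI / 2) < eps.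
Proof.
intros He.
assert (Hsin : forall x, 0 < x <= PI / 2 -> sin x <> 0).
{ intros x Hx. apply Rgt_not_eq, sin_gt_0; generalize PI_RGT_0; lra. }
destruct (riemann_lebesgue (fun x => / sin x - / x)
  (fun x => - cos x / sin x ^ 2 + / x ^ 2) (fun x => x) (fun _ => 1)
  (PI / 2) 1 eps PI2_pos Rlt_0_1 He) as [r0 [_ H]].
- intros x Hx. assert (H := Hsin x Hx). auto_derive; [repeat split; lra|].
  field. split; [lra|exact H].
- intros x Hx. assert (H := Hsin x Hx). by_derive.
  assert (x <> 0) by lra.
  repeat split; simpl; rewrite Rmult_1_r;
    apply Rmult_integral_contrapositive_currified; auto.
- intros x _. auto_derive; auto.
- intros x _. apply continuous_const.
- exists r0. intros N HN. set (r := INR (2 * N + 1)) in *.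
  specialize (H r (fun x => dirichlet_sum N x - dirichlet_kernel r x) HN).
  rewrite <- Rabs_Ropp.
  replace (- (Si (r * (PI / 2)) - PI / 2)) with
    (RInt (fun x => dirichlet_sum N x - dirichlet_kernel r x) 0 (PI / 2)).
  + assert (HK : forall x, 0 < x <= PI / 2 ->
      dirichlet_sum N x - dirichlet_kernel r x
      = (/ sin x - / x) * 1 * sin (r * x)).
    { intros x Hx. unfold r. rewrite dirichlet_kernel_neq_0 by lra.
      rewrite <- sin_mult_dirichlet_sum. field. split; [lra|now apply Hsin]. }
    apply H; [| |exact HK].
    * intros x _. apply (continuous_minus (dirichlet_sum N) (dirichlet_kernel r));
        [apply continuous_dirichlet_sum|apply continuous_dirichlet_kernel].
    * intros x Hx. destruct (Req_dec_T x 0) as [->|Hx0].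
      -- rewrite dirichlet_sum_0, dirichlet_kernel_x_0. unfold r.
         rewrite Rminus_diag, Rabs_R0. lra.
      -- rewrite HK by lra. rewrite Rmult_1_r, Rabs_mult, <- (Rmult_1_r 1).
         apply Rmult_le_compat; try apply Rabs_pos.
         ++ apply inv_sin_minus_inv_bound; lra.
         ++ apply Rabs_le, SIN_bound.
  + apply (is_RInt_unique (V := R_CompleteNormedModule)).
    replace (- (Si (r * (PI / 2)) - PI / 2)) with
      (PI / 2 - (Si (r * (PI / 2)) - Si (r * 0)))
      by (rewrite Rmult_0_r, Si_0; ring).
    apply (is_RInt_minus (V := R_NormedModule)); [apply is_RInt_dirichlet_sum|].
    apply (is_RInt_ext (V := R_NormedModule) (fun x => 1 * dirichlet_kernel r x)).
    * intros x _. apply Rmult_1_l.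
    * apply (is_RInt_dirichlet_kernel_comp r 0 (PI / 2) (fun x => x) (fun _ => 1)).
      -- exact PI2_pos_le.
      -- intros x. auto_derive; auto.
      -- intros x. apply continuous_const.
Qed.

Lemma Si_increment (x y : R) :
  0 < x <= y -> Rabs (Si y - Si x) <= (y - x) / x.
Proof.
intros Hxy.
assert (H : is_RInt sinc x y (Si y - Si x)).
{ apply is_RInt_primitive; [lra| |].
  - intros z _; apply is_derive_Si.
  - intros z _; apply continuous_sinc. }
rewrite <- (is_RInt_unique (V := R_CompleteNormedModule) _ _ _ _ H).
apply abs_RInt_le_const; [lra|eexists; exact H|].
intros z Hz. rewrite sinc_neq_0 by lra.
unfold Rdiv. rewrite Rabs_mult, Rabs_inv, (Rabs_pos_eq z) by lra.
rewrite <- (Rmult_1_l (/ x)).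
apply Rmult_le_compat; [apply Rabs_pos|left; apply Rinv_0_lt_compat; lra| |].
- apply Rabs_le, SIN_bound.
- apply Rinv_le_contravar; lra.
Qed.

(** Between consecutive odd multiples of pi / 2 the sine integral varies little
    ([Si_increment]), so its limit along them is its limit. *)
Lemma is_lim_Si : is_lim Si p_infty (PI / 2).
Proof.
apply is_lim_spec. intros eps. simpl.
assert (He := cond_pos eps).
destruct (Si_odd_multiples (eps / 2)) as [r0 H]; [lra|].
assert (HPI := PI2_pos).
assert (H4 : 0 < 4 / eps) by (apply Rdiv_lt_0_compat; lra).
(* A step of length at most pi from r pi/2 changes Si by at most 2 / r, which is
   below eps / 2 once r > 4 / eps. *)
set (r1 := Rmax r0 (4 / eps)).
assert (Hr1 : r0 <= r1 /\ 4 / eps <= r1) by (split; [apply Rmax_l|apply Rmax_r]).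
exists ((r1 + 2) * (PI / 2)). intros y Hy.
assert (Hy2 : r1 + 2 < y / (PI / 2)).
{ apply Rmult_lt_reg_r with (PI / 2); [exact HPI|].
  replace (y / (PI / 2) * (PI / 2)) with y by (field; lra). exact Hy. }
(* (2N + 1) pi/2 is the last odd multiple of pi/2 not beyond y. *)
destruct (nfloor_ex ((y / (PI / 2) - 1) / 2)) as [N [HN1 HN2]]; [lra|].
set (r := INR (2 * N + 1)).
assert (Hr : r = 2 * INR N + 1).
{ unfold r. rewrite plus_INR, mult_INR. simpl. ring. }
assert (Hrr : r1 < r) by lra.
assert (Hyr : r * (PI / 2) <= y <= (r + 2) * (PI / 2)).
{ replace y with (y / (PI / 2) * (PI / 2)) by (field; lra).
  split; apply Rmult_le_compat_r; lra. }
assert (B1 : Rabs (Si (r * (PI / 2)) - PI / 2) < eps / 2)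
  by (apply H; fold r; lra).
assert (B2 : Rabs (Si y - Si (r * (PI / 2))) < eps / 2).
{ eapply Rle_lt_trans; [apply Si_increment|].
  - split; [apply Rmult_lt_0_compat; lra|lra].
  - apply Rle_lt_trans with (2 / r).
    + apply Rmult_le_reg_r with (r * (PI / 2)); [apply Rmult_lt_0_compat; lra|].
      unfold Rdiv at 1. rewrite Rmult_assoc, Rinv_l, Rmult_1_r.
      * replace (2 / r * (r * (PI / 2))) with (2 * (PI / 2)) by (field; lra). lra.
      * apply Rgt_not_eq, Rmult_lt_0_compat; lra.
    + apply Rmult_lt_reg_r with r; [lra|].
      replace (2 / r * r) with 2 by (field; lra).
      apply Rle_lt_trans with (eps / 2 * (4 / eps)).
      * right; field; lra.
      * apply Rmult_lt_compat_l; lra. }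
replace (Si y - PI / 2) with
  ((Si y - Si (r * (PI / 2))) + (Si (r * (PI / 2)) - PI / 2)) by ring.
eapply Rle_lt_trans; [apply Rabs_triang|]. lra.
Qed.

Lemma is_lim_Si_scal (c : R) : 0 < c -> is_lim (fun r => Si (r * c)) p_infty (PI / 2).
Proof.
intros Hc. apply (is_lim_comp Si (fun r => r * c) p_infty (PI / 2) p_infty).
- exact is_lim_Si.
- apply is_lim_spec. intros M. simpl. exists (M / c). intros r Hr.
  replace M with (M / c * c) by (field; lra). now apply Rmult_lt_compat_r.
- exists 0. intros r _. discriminate.
Qed.

(** * The inversion formulas *)

(** With u = cos a, the kernel is compared with sin x / sin a times itself: the
    latter is the derivative of Si (r (cos a - cos x)) / sin a, and the difference is a
    multiple of cot ((a + x) / 2) sin (r (cos a - cos x)), which does not contribute. *)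
Lemma is_lim_dirichlet_interior (u : R) :
  0 < u < 1 ->
  is_lim (fun r => RInt (fun x => dirichlet_kernel r (u + -1 * cos x)) 0 (PI / 2))
    p_infty (PI / sqrt (1 - u ^ 2)).
Proof.
intros Hu.
set (a := acos u).
assert (Ha : 0 < a < PI / 2).
{ unfold a. assert (H := acos_bound_lt u ltac:(lra)). split; [lra|].
  apply Rnot_le_lt. intros Hle.
  assert (H2 : cos (acos u) <= cos (PI / 2)) by (apply cos_decr_1; lra).
  rewrite cos_acos, cos_PI2 in H2; lra. }
assert (Hcos : cos a = u) by (apply cos_acos; lra).
assert (Hsin : sin a = sqrt (1 - u ^ 2)).
{ unfold a. rewrite sin_acos by lra. unfold Rsqr. f_equal; ring. }
assert (Hsa : 0 < sin a) by (apply sin_gt_0; lra).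
assert (Hhalf : forall x, 0 <= x <= PI / 2 -> sin ((a + x) / 2) <> 0).
{ intros x Hx. apply Rgt_not_eq, sin_gt_0; lra. }
assert (Hcot : forall x, 0 <= x <= PI / 2 ->
  sin a - sin x = - (cos ((a + x) / 2) / sin ((a + x) / 2)) * (cos a - cos x)).
{ intros x Hx. assert (H := Hhalf x Hx).
  replace (sin a) with (sin ((a + x) / 2 + (a - x) / 2)) by (f_equal; field).
  replace (sin x) with (sin ((a + x) / 2 - (a - x) / 2)) by (f_equal; field).
  replace (cos a) with (cos ((a + x) / 2 + (a - x) / 2)) by (f_equal; field).
  replace (cos x) with (cos ((a + x) / 2 - (a - x) / 2)) by (f_equal; field).
  rewrite sin_plus, sin_minus, cos_plus, cos_minus. field. exact H. }
assert (L1 : is_lim (fun r =>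
   RInt (fun x => cos ((a + x) / 2) / sin ((a + x) / 2)
                  * sin (r * (u + -1 * cos x))) 0 (PI / 2)) p_infty 0).
{ apply (riemann_lebesgue_cos_phase _ (fun x => - / 2 / sin ((a + x) / 2) ^ 2));
    [lra| |].
  - intros x Hx. assert (H := Hhalf x Hx). auto_derive; [exact H|].
    assert (E := sin2_cos2 ((a + x) / 2)). unfold Rsqr in E.
    unfold Rdiv in *.
    set (S := sin ((a + x) * / 2)) in *. set (C := cos ((a + x) * / 2)) in *.
    replace (- / 2 * / S ^ 2) with (- (S * S + C * C) * / 2 * / S ^ 2)
      by (rewrite E; field; exact H).
    field. exact H.
  - intros x Hx. assert (H := Hhalf x Hx). by_derive. }
assert (L2 : is_lim (fun r => / sin a * ((Si (r * u) + Si (r * (1 - u)))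
   - RInt (fun x => cos ((a + x) / 2) / sin ((a + x) / 2)
                  * sin (r * (u + -1 * cos x))) 0 (PI / 2))) p_infty
   (/ sin a * ((PI / 2 + PI / 2) - 0))).
{ apply (is_lim_scal_l _ (/ sin a) p_infty (PI / 2 + PI / 2 - 0)).
  apply is_lim_minus'; [|exact L1].
  apply is_lim_plus'; apply is_lim_Si_scal; lra. }
replace (PI / sqrt (1 - u ^ 2)) with (/ sin a * ((PI / 2 + PI / 2) - 0))
  by (rewrite <- Hsin; field; lra).
revert L2. apply is_lim_ext. intros r. symmetry.
apply (is_RInt_unique (V := R_CompleteNormedModule)).
apply (is_RInt_ext (V := R_NormedModule)
  (fun x => / sin a * (sin x * dirichlet_kernel r (u + -1 * cos x)
     - cos ((a + x) / 2) / sin ((a + x) / 2) * sin (r * (u + -1 * cos x))))).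
{ intros x. rewrite Rmin_left, Rmax_right by exact PI2_pos_le. intros Hx.
  rewrite <- mult_dirichlet_kernel.
  assert (H := Hcot x ltac:(lra)). rewrite Hcos in H.
  transitivity (/ sin a * ((sin x +
    - (cos ((a + x) / 2) / sin ((a + x) / 2)) * (u - cos x))
    * dirichlet_kernel r (u + -1 * cos x))).
  - unfold Rminus. simpl. ring.
  - rewrite <- H. simpl. field. lra. }
apply (is_RInt_scal (V := R_NormedModule)).
apply (is_RInt_minus (V := R_NormedModule)).
- replace (Si (r * u) + Si (r * (1 - u)))
    with (Si (r * (u + -1 * cos (PI / 2))) - Si (r * (u + -1 * cos 0))).
  + apply (is_RInt_dirichlet_kernel_comp r 0 (PI / 2) (fun x => u + -1 * cos x) sin).
    * exact PI2_pos_le.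
    * intros x. auto_derive; [auto|ring].
    * intros x. by_derive.
  + rewrite cos_PI2, cos_0.
    replace (r * (u + -1 * 1)) with (- (r * (1 - u))) by ring.
    rewrite Si_opp, Rmult_0_r, Rplus_0_r. ring.
- apply (RInt_correct (V := R_CompleteNormedModule)
    (fun x => cos ((a + x) / 2) / sin ((a + x) / 2) * sin (r * (u + -1 * cos x)))).
  apply ex_RInt_continuous_le; [exact PI2_pos_le|].
  intros x Hx. assert (H := Hhalf x Hx). by_derive.
Qed.

Lemma chebyshevT_opp (m : nat) (x : R) :
  chebyshevT m (- x) = (-1) ^ m * chebyshevT m x.
Proof.
enough (H : chebyshevT m (- x) = (-1) ^ m * chebyshevT m x /\
            chebyshevT (S m) (- x) = (-1) ^ S m * chebyshevT (S m) x) by apply H.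
induction m as [|m [IH1 IH2]].
- split; simpl; ring.
- split; [exact IH2|].
  change (chebyshevT (S (S m)) (- x))
    with (2 * - x * chebyshevT (S m) (- x) - chebyshevT m (- x)).
  change (chebyshevT (S (S m)) x)
    with (2 * x * chebyshevT (S m) x - chebyshevT m x).
  rewrite IH1, IH2. simpl. ring.
Qed.

Definition kernel_integral (m : nat) (u s r : R) : R :=
  RInt (fun x => cos (INR m * x) * dirichlet_kernel r (u + s * cos x)) 0 (PI / 2).

(** For s = 1 or -1, (- s) ^ m cos (m x) is T_m (- s cos x), by the parity of T_m. *)
Lemma is_lim_kernel_integral (m : nat) (u s l : R) :
  s ^ 2 = 1 ->
  is_lim (fun r => chebyshevT m u
            * RInt (fun x => dirichlet_kernel r (u + s * cos x)) 0 (PI / 2))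
    p_infty l ->
  is_lim (fun r => (- s) ^ m * kernel_integral m u s r) p_infty l.
Proof.
intros Hs Hl. generalize (is_lim_chebyshev_dirichlet m u s l Hs Hl).
apply is_lim_ext. intros r.
assert (Hs' : s = 1 \/ s = -1).
{ destruct (Rmult_integral (s - 1) (s + 1)); [simpl in Hs; lra|left; lra|right; lra]. }
apply (is_RInt_unique (V := R_CompleteNormedModule)).
apply (is_RInt_ext (V := R_NormedModule)
  (fun x => (- s) ^ m * (cos (INR m * x) * dirichlet_kernel r (u + s * cos x)))).
- intros x _. rewrite <- chebyshevT_cos.
  destruct Hs' as [-> | ->].
  + replace (- (1) * cos x) with (- cos x) by ring.
    rewrite chebyshevT_opp. apply eq_sym, Rmult_assoc.
  + replace (- (-1)) with 1 by ring. rewrite pow1, !Rmult_1_l. reflexivity.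
- apply (is_RInt_scal (V := R_NormedModule)).
  apply (RInt_correct (V := R_CompleteNormedModule)
   (fun x => cos (INR m * x) * dirichlet_kernel r (u + s * cos x))).
  apply ex_RInt_continuous_le; [exact PI2_pos_le|]. intros x _.
  apply (continuous_mult (fun x => cos (INR m * x))
    (fun x => dirichlet_kernel r (u + s * cos x))); [by_derive|].
  apply continuous_dirichlet_kernel_cos.
Qed.

(** At u = 0 the kernels K_r (u - cos x) and K_r (u + cos x) are both singular at the
    endpoint pi / 2; the hypothesis on T_m makes their contribution vanish. *)
Lemma is_lim_kernel_integral_difference (m : nat) (u : R) :
  0 <= u -> u <> 1 -> (u = 0 -> chebyshevT m u = 0) ->
  is_lim (fun r => (kernel_integral m u (-1) r
                    - (-1) ^ m * kernel_integral m u 1 r) / 2) p_infty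
    (PI / 2 * (chebyshevT m u / sqrt (1 - u ^ 2) * unit_step (1 - u))).
Proof.
intros Hu0 Hu1 Hodd.
assert (HT0 : chebyshevT m u = 0 -> forall s,
  is_lim (fun r => chebyshevT m u
            * RInt (fun x => dirichlet_kernel r (u + s * cos x)) 0 (PI / 2))
    p_infty 0).
{ intros HT s. apply (is_lim_ext (fun _ => 0)); [|apply is_lim_const].
  intros r. rewrite HT. ring. }
assert (Hcos : forall x, 0 <= x <= PI / 2 -> 0 <= cos x <= 1).
{ intros x Hx. split; [apply cos_ge_0; generalize PI_RGT_0; lra|apply COS_bound]. }
assert (L1 : is_lim (fun r => (-1) ^ m * kernel_integral m u 1 r) p_infty 0).
{ apply (is_lim_kernel_integral m u 1 0); [ring|].
  destruct (Req_dec_T u 0) as [Hz|Hz]; [now apply HT0, Hodd|].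
  assert (L := is_lim_scal_l _ (chebyshevT m u) p_infty 0
    (is_lim_dirichlet_nonvanishing u 1 ltac:(lra)
       ltac:(intros x Hx; generalize (Hcos x Hx); lra))).
  simpl in L. rewrite Rmult_0_r in L. exact L. }
assert (L2 : is_lim (kernel_integral m u (-1)) p_infty
  (chebyshevT m u * (PI / sqrt (1 - u ^ 2) * unit_step (1 - u)))).
{ apply (is_lim_ext (fun r => (- (-1)) ^ m * kernel_integral m u (-1) r)).
  { intros r. replace (- (-1)) with 1 by ring. rewrite pow1. ring. }
  apply is_lim_kernel_integral; [ring|].
  destruct (Req_dec_T u 0) as [Hz|Hz].
  { replace (chebyshevT m u * (PI / sqrt (1 - u ^ 2) * unit_step (1 - u))) with 0
      by (rewrite (Hodd Hz); ring).
    now apply HT0, Hodd. }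
  apply (is_lim_scal_l _ (chebyshevT m u) p_infty
    (PI / sqrt (1 - u ^ 2) * unit_step (1 - u))).
  unfold unit_step. destruct (Rlt_dec 0 (1 - u)) as [Hlt|Hge].
  - rewrite Rmult_1_r. apply is_lim_dirichlet_interior. lra.
  - rewrite Rmult_0_r. apply is_lim_dirichlet_nonvanishing; [lra|].
    intros x Hx. generalize (Hcos x Hx). lra. }
assert (L := is_lim_scal_r _ (/ 2) p_infty _ (is_lim_minus' _ _ _ _ _ L2 L1)).
replace (PI / 2 * (chebyshevT m u / sqrt (1 - u ^ 2) * unit_step (1 - u)))
  with ((chebyshevT m u * (PI / sqrt (1 - u ^ 2) * unit_step (1 - u)) - 0) * / 2)
  by (unfold Rdiv; ring).
exact L.
Qed.

Lemma is_RInt_kernel_integral (m : nat) (u s r : R) :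
  0 <= r ->
  is_RInt (fun t => RInt (fun x => cos (INR m * x) * cos (t * (u + s * cos x)))
                      0 (PI / 2)) 0 r (kernel_integral m u s r).
Proof.
intros Hr.
apply (is_RInt_RInt_cos (fun x => cos (INR m * x)) (fun x => u + s * cos x));
  [exact Hr| |]; intros x; by_derive.
Qed.

Lemma is_RInt_cos_phase (m : nat) (u s t : R) :
  is_RInt (fun x => cos (INR m * x) * cos (t * (u + s * cos x))) 0 (PI / 2)
    (RInt (fun x => cos (INR m * x) * cos (t * (u + s * cos x))) 0 (PI / 2)).
Proof.
apply (RInt_correct (V := R_CompleteNormedModule)
  (fun x => cos (INR m * x) * cos (t * (u + s * cos x)))).
apply ex_RInt_continuous_le; [exact PI2_pos_le|]. intros x _; by_derive.
Qed.

(** Product-to-sum: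
    2 sin (u t) sin (t cos x) = cos (t (u - cos x)) - cos (t (u + cos x)). *)
Lemma is_RInt_sin_transform (m : nat) (u r : R) :
  0 <= r ->
  is_RInt (fun t => sin (u * t) * cos_sin_transform (INR m) t) 0 r
    ((kernel_integral m u (-1) r - kernel_integral m u 1 r) / 2).
Proof.
intros Hr.
apply (is_RInt_ext (V := R_NormedModule) (fun t => / 2 *
  (RInt (fun x => cos (INR m * x) * cos (t * (u + -1 * cos x))) 0 (PI / 2)
   - RInt (fun x => cos (INR m * x) * cos (t * (u + 1 * cos x))) 0 (PI / 2)))).
- intros t _. symmetry.
  apply (is_RInt_det (fun x => sin (u * t) * (sin (t * cos x) * cos (INR m * x)))
           0 (PI / 2)).
  + apply (is_RInt_scal (V := R_NormedModule)), is_RInt_cos_sin_transform.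
  + apply (is_RInt_ext (V := R_NormedModule) (fun x => / 2 *
      (cos (INR m * x) * cos (t * (u + -1 * cos x))
       - cos (INR m * x) * cos (t * (u + 1 * cos x))))).
    * intros x _.
      replace (t * (u + -1 * cos x)) with (u * t - t * cos x) by ring.
      replace (t * (u + 1 * cos x)) with (u * t + t * cos x) by ring.
      rewrite cos_minus, cos_plus. simpl. field.
    * apply (is_RInt_scal (V := R_NormedModule)).
      apply (is_RInt_minus (V := R_NormedModule)); apply is_RInt_cos_phase.
- replace ((kernel_integral m u (-1) r - kernel_integral m u 1 r) / 2)
    with (/ 2 * (kernel_integral m u (-1) r - kernel_integral m u 1 r)) by field.
  apply (is_RInt_scal (V := R_NormedModule)).
  apply (is_RInt_minus (V := R_NormedModule)); now apply is_RInt_kernel_integral.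
Qed.

(** Product-to-sum:
    2 cos (u t) cos (t cos x) = cos (t (u - cos x)) + cos (t (u + cos x)). *)
Lemma is_RInt_cos_transform (m : nat) (u r : R) :
  0 <= r ->
  is_RInt (fun t => cos (u * t) * cos_cos_transform (INR m) t) 0 r
    ((kernel_integral m u (-1) r + kernel_integral m u 1 r) / 2).
Proof.
intros Hr.
apply (is_RInt_ext (V := R_NormedModule) (fun t => / 2 *
  (RInt (fun x => cos (INR m * x) * cos (t * (u + -1 * cos x))) 0 (PI / 2)
   + RInt (fun x => cos (INR m * x) * cos (t * (u + 1 * cos x))) 0 (PI / 2)))).
- intros t _. symmetry.
  apply (is_RInt_det (fun x => cos (u * t) * (cos (t * cos x) * cos (INR m * x)))
           0 (PI / 2)).
  + apply (is_RInt_scal (V := R_NormedModule)), is_RInt_cos_cos_transform.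
  + apply (is_RInt_ext (V := R_NormedModule) (fun x => / 2 *
      (cos (INR m * x) * cos (t * (u + -1 * cos x))
       + cos (INR m * x) * cos (t * (u + 1 * cos x))))).
    * intros x _.
      replace (t * (u + -1 * cos x)) with (u * t - t * cos x) by ring.
      replace (t * (u + 1 * cos x)) with (u * t + t * cos x) by ring.
      rewrite cos_minus, cos_plus. simpl. field.
    * apply (is_RInt_scal (V := R_NormedModule)).
      apply (is_RInt_plus (V := R_NormedModule)); apply is_RInt_cos_phase.
- replace ((kernel_integral m u (-1) r + kernel_integral m u 1 r) / 2)
    with (/ 2 * (kernel_integral m u (-1) r + kernel_integral m u 1 r)) by field.
  apply (is_RInt_scal (V := R_NormedModule)).
  apply (is_RInt_plus (V := R_NormedModule)); now apply is_RInt_kernel_integral.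
Qed.

Lemma is_RInt_gen_0_oo_scal (f h L : R -> R) (c l : R) :
  (forall t, f t = c * h t) ->
  (forall r, 0 <= r -> is_RInt h 0 r (L r)) ->
  is_lim L p_infty l ->
  is_RInt_gen f (at_point 0) (Rbar_locally p_infty) (c * l).
Proof.
intros Hf Hh HL.
apply (is_RInt_gen_of_lim f (fun r => c * L r)).
- typeclasses eauto.
- exists 0. intros r Hr.
  apply (is_RInt_ext (V := R_NormedModule) (fun t => c * h t)).
  + intros t _. now rewrite Hf.
  + apply (is_RInt_scal (V := R_NormedModule)), Hh. lra.
- exact (is_lim_scal_l L c p_infty l HL).
Qed.

Lemma continuous_chebyshevT (m : nat) (x : R) : continuous (chebyshevT m) x.
Proof.
destruct (chebyshevT_divided_difference m 0) as [Q [Q' [HQ [HQ1 _]]]].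
apply (continuous_ext (fun x => chebyshevT m 0 + (x - 0) * Q x)).
{ intros y. rewrite <- HQ. simpl. ring. }
apply (continuous_plus (fun _ => chebyshevT m 0) (fun x => (x - 0) * Q x));
  [apply continuous_const|].
apply (continuous_mult (fun x => x - 0) Q); [by_derive|].
apply (ex_derive_continuous (V := R_NormedModule)). eexists; apply HQ1.
Qed.

Lemma is_RInt_gen_chebyshevT_0_1 (m : nat) (h : R -> R) (t : R) :
  (forall y, continuous h y) ->
  is_RInt_gen (fun u => h (u * t) * (chebyshevT m u / sqrt (1 - u ^ 2)))
    (at_point 0) (at_left 1)
    (RInt (fun x => h (t * cos x) * cos (INR m * x)) 0 (PI / 2)).
Proof.
intros Hh.
assert (H := is_RInt_gen_chebyshev_weight (fun u => h (u * t) * chebyshevT m u)).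
replace (RInt (fun x => h (t * cos x) * cos (INR m * x)) 0 (PI / 2))
  with (RInt (fun x => h (cos x * t) * chebyshevT m (cos x)) 0 (PI / 2)).
- apply (is_RInt_gen_ext (fun u => h (u * t) * chebyshevT m u / sqrt (1 - u ^ 2))).
  + apply filter_forall. intros ab u _. unfold Rdiv. apply Rmult_assoc.
  + apply H. intros x. apply (continuous_mult (fun u => h (u * t)) (chebyshevT m)).
    * apply (continuous_comp (fun u => u * t) h); [by_derive|apply Hh].
    * apply continuous_chebyshevT.
- apply (RInt_ext (V := R_CompleteNormedModule)). intros x _.
  now rewrite chebyshevT_cos, Rmult_comm with (r1 := cos x).
Qed.

Lemma cos_INR_PI (n : nat) : cos (INR n * PI) = (-1) ^ n.
Proof.
induction n as [|n IH]; [simpl; now rewrite Rmult_0_l, cos_0|].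
rewrite S_INR. replace ((INR n + 1) * PI) with (INR n * PI + PI) by ring.
rewrite neg_cos, IH. simpl. ring.
Qed.

Lemma pow_opp1_sqr (n : nat) : (-1) ^ n * (-1) ^ n = 1.
Proof. rewrite <- Rpow_mult_distr. replace (-1 * -1) with 1 by ring. apply pow1. Qed.

(** The two squares have different parity. This is what keeps the denominators of
    both Lommel functions away from 0. *)
Lemma odd_sqr_neq_even_sqr (j n : nat) :
  (2 * INR j + 1) ^ 2 - INR (2 * n) ^ 2 <> 0.
Proof.
intros H.
assert (E : INR ((2 * j + 1) * (2 * j + 1)) = INR (2 * n * (2 * n))).
{ rewrite !mult_INR, plus_INR, !mult_INR. rewrite mult_INR in H. simpl in *. lra. }
apply INR_eq in E. lia.
Qed.

Lemma lommel_even (n : nat) (t : R) :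
  lommel 0 (INR (2 * n)) t = (-1) ^ n * cos_sin_transform (INR (2 * n)) t.
Proof.
rewrite cos_sin_transform_lommel by (intros j; apply odd_sqr_neq_even_sqr).
replace (INR (2 * n) * (PI / 2)) with (INR n * PI)
  by (rewrite mult_INR; simpl; field).
rewrite cos_INR_PI, <- Rmult_assoc, pow_opp1_sqr. ring.
Qed.

Lemma lommel_odd (n : nat) (t : R) :
  lommel (-1) (INR (2 * n + 1)) t
  = (-1) ^ (n + 1) / INR (2 * n + 1) * cos_cos_transform (INR (2 * n + 1)) t.
Proof.
rewrite cos_cos_transform_lommel.
- replace (INR (2 * n + 1) * (PI / 2)) with (INR n * PI + PI / 2)
    by (rewrite plus_INR, mult_INR; simpl; field).
  rewrite sin_plus, cos_PI2, sin_PI2, cos_INR_PI, pow_add.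
  transitivity ((-1) ^ n * (-1) ^ n * lommel (-1) (INR (2 * n + 1)) t).
  + rewrite pow_opp1_sqr. ring.
  + field. apply not_0_INR. lia.
- intros j H. apply (odd_sqr_neq_even_sqr n j).
  rewrite plus_INR, !mult_INR in *. simpl in *. lra.
Qed.

Theorem theorem2 (n : nat) :
  (forall u : R, 0 < u -> u <> 1 ->
     ex_RInt_0_oo (fun t => sin (u * t) * lommel 0 (INR (2 * n)) t) /\
     chebyshevT (2 * n) u / sqrt (1 - u ^ 2) * unit_step (1 - u)
     = (-1) ^ n * (2 / PI)
       * RInt_0_oo (fun t => sin (u * t) * lommel 0 (INR (2 * n)) t)) /\
  (forall u : R, 0 <= u -> u <> 1 ->
     ex_RInt_0_oo (fun t => cos (u * t) * lommel (-1) (INR (2 * n + 1)) t) /\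
     chebyshevT (2 * n + 1) u / sqrt (1 - u ^ 2) * unit_step (1 - u)
     = (-1) ^ (n + 1) * INR (2 * n + 1) * (2 / PI)
       * RInt_0_oo (fun t => cos (u * t) * lommel (-1) (INR (2 * n + 1)) t)) /\
  (forall t : R,
     ex_RInt_0_1 (fun u => sin (u * t)
                           * (chebyshevT (2 * n) u / sqrt (1 - u ^ 2))) /\
     lommel 0 (INR (2 * n)) t
     = (-1) ^ n
       * RInt_0_1 (fun u => sin (u * t)
                            * (chebyshevT (2 * n) u / sqrt (1 - u ^ 2)))) /\
  (forall t : R,
     ex_RInt_0_1 (fun u => cos (u * t)
                           * (chebyshevT (2 * n + 1) u / sqrt (1 - u ^ 2))) /\
     lommel (-1) (INR (2 * n + 1)) t
     = (-1) ^ (n + 1) / INR (2 * n + 1)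
       * RInt_0_1 (fun u => cos (u * t)
                            * (chebyshevT (2 * n + 1) u / sqrt (1 - u ^ 2)))).
Proof.
assert (Hsgn0 : (-1) ^ (2 * n) = 1)
  by (rewrite pow_mult; replace ((-1) ^ 2) with 1 by ring; apply pow1).
assert (Hsgn1 : (-1) ^ (2 * n + 1) = -1) by (rewrite pow_add, Hsgn0; ring).
assert (HPI := PI_RGT_0).
assert (Hm : INR (2 * n + 1) <> 0) by (apply not_0_INR; lia).
split; [|split; [|split]].
- intros u Hu Hu1.
  destruct (is_RInt_gen_value _ _ _ _ (is_RInt_gen_0_oo_scal
    (fun t => sin (u * t) * lommel 0 (INR (2 * n)) t)
    (fun t => sin (u * t) * cos_sin_transform (INR (2 * n)) t)
    (fun r => (kernel_integral (2 * n) u (-1) r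
               - (-1) ^ (2 * n) * kernel_integral (2 * n) u 1 r) / 2)
    ((-1) ^ n) _
    ltac:(intros t; cbv beta; rewrite lommel_even; ring)
    ltac:(intros r Hr; cbv beta; rewrite Hsgn0, Rmult_1_l;
          now apply is_RInt_sin_transform)
    (is_lim_kernel_integral_difference (2 * n) u ltac:(lra) Hu1 ltac:(lra))))
    as [Hex Hval].
  split; [exact Hex|]. rewrite Hval.
  transitivity ((-1) ^ n * (-1) ^ n
    * (chebyshevT (2 * n) u / sqrt (1 - u ^ 2) * unit_step (1 - u))).
  + rewrite pow_opp1_sqr. ring.
  + set (X := chebyshevT (2 * n) u / sqrt (1 - u ^ 2)). field. lra.
- intros u Hu Hu1.
  destruct (is_RInt_gen_value _ _ _ _ (is_RInt_gen_0_oo_scal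
    (fun t => cos (u * t) * lommel (-1) (INR (2 * n + 1)) t)
    (fun t => cos (u * t) * cos_cos_transform (INR (2 * n + 1)) t)
    (fun r => (kernel_integral (2 * n + 1) u (-1) r
               - (-1) ^ (2 * n + 1) * kernel_integral (2 * n + 1) u 1 r) / 2)
    ((-1) ^ (n + 1) / INR (2 * n + 1)) _
    ltac:(intros t; cbv beta; rewrite lommel_odd; ring)
    ltac:(intros r Hr; cbv beta; rewrite Hsgn1;
          replace (kernel_integral (2 * n + 1) u (-1) r
                   - -1 * kernel_integral (2 * n + 1) u 1 r)
            with (kernel_integral (2 * n + 1) u (-1) r
                  + kernel_integral (2 * n + 1) u 1 r) by ring;
          now apply is_RInt_cos_transform)
    (is_lim_kernel_integral_difference (2 * n + 1) u Hu Hu1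
       ltac:(intros ->; generalize (chebyshevT_opp (2 * n + 1) 0);
             rewrite Ropp_0, Hsgn1; lra))))
    as [Hex Hval].
  split; [exact Hex|]. rewrite Hval.
  transitivity ((-1) ^ (n + 1) * (-1) ^ (n + 1)
    * (chebyshevT (2 * n + 1) u / sqrt (1 - u ^ 2) * unit_step (1 - u))).
  + rewrite pow_opp1_sqr. ring.
  + set (X := chebyshevT (2 * n + 1) u / sqrt (1 - u ^ 2)).
    field. split; [exact Hm|lra].
- intros t.
  destruct (is_RInt_gen_value _ _ _ (at_left 1)
    (is_RInt_gen_chebyshevT_0_1 (2 * n) sin t ltac:(intros y; by_derive)))
    as [Hex Hval].
  split; [exact Hex|]. rewrite Hval. apply lommel_even.
- intros t.
  destruct (is_RInt_gen_value _ _ _ (at_left 1)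
    (is_RInt_gen_chebyshevT_0_1 (2 * n + 1) cos t ltac:(intros y; by_derive)))
    as [Hex Hval].
  split; [exact Hex|]. rewrite Hval. apply lommel_odd.
Qed.
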